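(* Let $\{t(q_i)\}_{i\ge 1}$ be independent (not necessarily identically distributed) passage times on the edges of $\mathbb{Z}^d$, $d\ge 2$, and let $T_n$ be the minimum passage time between the origin and $(n,0,\ldots,0)$. Consider the conditions: (i) $\sup_i \mathbb{P}(t(q_i)<\epsilon)\to 0$ as $\epsilon\downarrow 0$; (ii) $\sup_i \mathbb{E}t^2(q_i)<\infty$; (ii)(a) $\sup_{i}\mathbb{E}\left[t^2(q_i)\mathbf{1}(t(q_i)\ge M)\right]\to 0$ as $M\to\infty$; (ii)(b) $\sup_i\mathbb{E}t^p(q_i)<\infty$ for some $p>2$. If (i) and (ii) hold, then $$\frac{1}{n}\left(T_n-\mathbb{E}T_n\right)\longrightarrow 0 \quad\text{almost surely and in } L^1$$ as $n\to\infty$. If (i) and (ii)(a) hold, then this convergence holds almost surely and in $L^2$. If (i) and (ii)(b) hold, then the convergence holds almost surely and in $L^2$, and in addition there is a constant $C>0$ such that $$\mathrm{var}(T_n-\mathbb{E}T_n)\le Cn\quad\text{for all } n\ge 1.$$ In all the cases there are constants $\eta_1,\eta_2\in(0,\infty)$ such that $$\eta_1\le\liminf_n\frac{T_n}{n}\le\limsup_n\frac{T_n}{n}\le\eta_2\quad\text{almost surely.}$$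
   Context: Two vertices of $\mathbb{Z}^d$ are adjacent if their $\ell^1$-distance is $1$, and adjacent vertices are joined by an edge; $\{q_i\}_{i\ge1}$ is an enumeration of all edges. Each edge $q_i$ carries a real random passage time $t(q_i)$, all defined on a common probability space $(\Omega,\mathcal{F},\mathbb{P})$ (the product space $\mathbb{R}^{\mathbb{N}}$ with its product sigma-field). A path is a finite self-avoiding nearest-neighbour path, viewed as a sequence of distinct edges $\pi=(e_1,\ldots,e_r)$; its passage time is $T(\pi)=\sum_{i=1}^r t(e_i)$. $T_n=\inf_\pi T(\pi)$, the infimum over all finite paths $\pi$ with endvertices the origin and $(n,0,\ldots,0)$. *)

(* Defs.v *)
From HB Require Import structures.
From mathcomp Require Import all_boot all_order all_algebra finmap.
From mathcomp Require Import all_classical all_reals all_analysis.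
Import Order.TTheory GRing.Theory Num.Theory.
Import numFieldNormedType.Exports.

Set Implicit Arguments.
Unset Strict Implicit.
Unset Printing Implicit Defensive.

Local Open Scope classical_set_scope.
Local Open Scope ring_scope.

Section Lattice.
Variable d : nat.

Definition lattice_adjacent : rel 'rV[int]_d :=
  fun x y => \sum_(i < d) `|x ord0 i - y ord0 i| == 1.

Definition lattice_edges : set {fset 'rV[int]_d} :=
  [set e | exists x y, lattice_adjacent x y /\ e = [fset x; y]%fset].

Definition axis_point (n : nat) : 'rV[int]_d :=
  \row_(i < d) (if i == 0%N :> nat then n%:Z else 0).

(* The path visiting x and then, in order, the vertices of the list p. *)
Definition self_avoiding_path (x y : 'rV[int]_d) (p : seq 'rV[int]_d) : bool :=
  [&& path lattice_adjacent x p, last x p == y & uniq (x :: p)].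

Definition path_edges (x : 'rV[int]_d) (p : seq 'rV[int]_d) :
    seq {fset 'rV[int]_d} :=
  pairmap (fun u v => [fset u; v]%fset) x p.

Variable R : realType.

Definition passage_time (tau : {fset 'rV[int]_d} -> R)
    (x : 'rV[int]_d) (p : seq 'rV[int]_d) : R :=
  \sum_(e <- path_edges x p) tau e.

(* [inf] is 0 on sets not bounded below; this can only happen when some edge
   weights are negative, which has probability zero under [vanishing_near_zero]
   below. *)
Definition first_passage_time (tau : {fset 'rV[int]_d} -> R) (n : nat) : R :=
  inf [set passage_time tau 0 p |
        p in [set p | self_avoiding_path 0 (axis_point n) p]].

End Lattice.

Section Probability.
Context (disp : measure_display) (Omega : measurableType disp) (R : realType).
Variable P : probability Omega R.
Local Open Scope ereal_scope.

Definition mutually_independent (X : nat -> Omega -> R) : Prop :=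
  forall (J : {fset nat}) (B : nat -> set R),
    (forall i, measurable (B i)) ->
    P (\bigcap_(i in [set` J]) (X i @^-1` B i)) =
      \prod_(i <- J) P (X i @^-1` B i).

Definition vanishing_near_zero (X : nat -> Omega -> R) : Prop :=
  ereal_sup (range (fun i => P [set w | (X i w < e)%R])) @[e --> 0%R^'+] --> 0.

Definition bounded_second_moments (X : nat -> Omega -> R) : Prop :=
  ereal_sup (range (fun i => 'E_P[fun w => (X i w ^+ 2)%R])) < +oo.

Definition vanishing_second_moment_tails (X : nat -> Omega -> R) : Prop :=
  ereal_sup (range (fun i =>
    'E_P[fun w => (X i w ^+ 2 * \1_[set u | M <= X i u] w)%R]))
    @[M --> +oo%R] --> 0.

Definition bounded_higher_moments (X : nat -> Omega -> R) : Prop :=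
  exists p : R, (2 < p)%R /\
    ereal_sup (range (fun i => 'E_P[fun w => (X i w `^ p)%R])) < +oo.

Definition cvg_almost_surely (X : nat -> Omega -> R) (Y : Omega -> R) : Prop :=
  {ae P, forall w, X n w @[n --> \oo] --> Y w}.

Definition cvg_Lp (p : \bar R) (X : nat -> Omega -> R) (Y : Omega -> R) : Prop :=
  [/\ forall n, X n \in Lfun P p,
      Y \in Lfun P p &
      'N[P]_p[EFin \o (X n \- Y)%R] @[n --> \oo] --> 0].

(* [fine] is harmless: it is used together with [cvg_Lp], which forces the
   variables X n, n >= 1, to be integrable. *)
Definition centered (X : Omega -> R) : Omega -> R :=
  fun w => (X w - fine 'E_P[X])%R.

Definition linear_growth (T : nat -> Omega -> R) : Prop :=
  exists eta1 eta2 : R, [/\ (0 < eta1)%R, (0 < eta2)%R &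
    {ae P, forall w,
      [/\ eta1%:E <= limn_einf (fun n => (T n w / n%:R)%:E),
          limn_einf (fun n => (T n w / n%:R)%:E) <=
            limn_esup (fun n => (T n w / n%:R)%:E) &
          limn_esup (fun n => (T n w / n%:R)%:E) <= eta2%:E]}].

End Probability.

(* Main.v *)
Require Import Defs.
From HB Require Import structures.
From mathcomp Require Import all_boot all_order all_algebra finmap.
From mathcomp Require Import all_classical all_reals all_analysis.
From mathcomp Require Import measurable_realfun lra ring zify.
Import Order.TTheory GRing.Theory Num.Theory.
Import numFieldNormedType.Exports.

(** The passage time concentrates because its variance grows at most linearly,
    and bounded second moments are enough for that. Given the vanishing mass
    near 0, each of the two stronger moment conditions implies that second
    moments are bounded ([bounded_second_moments_of_tails] and
    [bounded_second_moments_of_higher]), and the weights are nonnegative almost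
    surely, so that they may be replaced by their positive parts.

    The Efron-Stein inequality ([efron_stein]) bounds the variance by the sum
    over the edges [e] of the mean of [(T' - T)_+ ^ 2], where [T'] is the
    passage time after the weight of [e] has been resampled. The passage time
    increases only if [e] lies on every optimal path, and then by at most the
    new weight ([truncated_time_resample]). The new weight is independent of
    the optimal paths, so the variance is at most the largest second moment of
    a weight times the mean length of an optimal path. This length is bounded
    as follows: a union bound over the [(2 * d) ^ r] walks and the [2 ^ r] sets
    of edges shows that, except with probability [2 ^- r], no self-avoiding
    path with [r] edges from the origin is crossed in time less than [eps / 2]
    per edge ([fast_path_probability]). Hence the length of an optimal path is
    at most [2 / eps] times its passage time, up to a variable of bounded mean,
    while this passage time is at most the one of the axis, with a mean of
    order [n]. The inequality is applied to functions of finitely many weights,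
    namely the passage times truncated and restricted to short paths
    ([truncated_variance]), before passing to the limit
    ([first_passage_variance]).

    The independent copy of the weights lives on the second factor of [Omega *
    Omega], and only one property of it is used: exchanging the two copies at
    an arbitrary set of edges preserves their joint law ([exchange_law]),
    because rectangles form a pi-system.

    Convergence in [L^2], hence in [L^1], follows at once from the bound on
    the variance. Almost sure convergence follows along the squares from
    Chebyshev's inequality and the Borel-Cantelli lemma; between two
    consecutive squares, the passage time varies by at most the passage time
    of a segment of the axis ([strong_law]). The lower bound on the growth
    is another application of [fast_path_probability], since a path to the
    [n]-th point of the axis has at least [n] edges, and the upper bound
    follows from the bound on the mean. *)

Set Implicit Arguments.
Unset Strict Implicit.
Unset Printing Implicit Defensive.

Local Open Scope classical_set_scope.
Local Open Scope ring_scope.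

(** * Lattice paths and first passage times *)

Section LatticePaths.
Variable d : nat.
Implicit Types (x y : 'rV[int]_d) (p : seq 'rV[int]_d).

(** The [2 * d] lattice vectors of norm 1. *)
Definition unit_steps : seq 'rV[int]_d :=
  [seq delta_mx ord0 i | i : 'I_d] ++
  [seq - delta_mx ord0 i | i : 'I_d].

Lemma size_unit_steps : size unit_steps = (d + d)%N.
Proof. by rewrite size_cat !size_image card_ord. Qed.

Lemma lattice_adjacent_step x y :
  lattice_adjacent x y -> exists2 s, s \in unit_steps & y = x + s.
Proof.
rewrite /lattice_adjacent => /eqP h.
have [i hi] : exists i : 'I_d, x ord0 i - y ord0 i != 0.
  apply/existsP; apply: contraTT isT; rewrite negb_exists => /forallP h0.
  suff : (0 : int) = 1 by [].
  rewrite -h big1// => i _; have := h0 i; rewrite negbK => /eqP ->.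
  by rewrite normr0.
have hi1 : (1 <= `|x ord0 i - y ord0 i|)%R by rewrite -gtz0_ge1 normr_gt0.
have hs : \sum_(j < d | j != i) `|x ord0 j - y ord0 j| = 0.
  apply/eqP; rewrite eq_le sumr_ge0// andbT.
  move: h; rewrite (bigD1 i)//= => h; rewrite -(lerD2l `|x ord0 i - y ord0 i|).
  by rewrite h addr0.
have ho j : j != i -> x ord0 j = y ord0 j.
  move=> ji; apply/eqP; rewrite -subr_eq0 -normr_eq0; apply/eqP.
  by move/eqP: hs; rewrite psumr_eq0// => /allP/(_ j);
    rewrite mem_index_enum ji => /(_ isT)/eqP.
have hi2 : `|x ord0 i - y ord0 i| = 1 by move: h; rewrite (bigD1 i)//= hs addr0.
exists (y - x); last by rewrite addrC subrK.
rewrite mem_cat; apply/orP.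
have [hp|hn] := lerP (x ord0 i - y ord0 i) 0.
  left; apply/mapP; exists i; first by rewrite mem_enum.
  move: hi2; rewrite ler0_norm// opprB => hi2.
  apply/rowP => j; rewrite !mxE eqxx/=; case: eqVneq => [->//|ji].
  by rewrite ho// subrr.
right; apply/mapP; exists i; first by rewrite mem_enum.
move: hi2; rewrite gtr0_norm// => hi2.
apply/rowP => j; rewrite !mxE eqxx/=; case: eqVneq => [->|ji].
  by rewrite -hi2 opprB.
by rewrite ho// subrr oppr0.
Qed.

(** [walks r x] lists the nearest-neighbour walks with [r] steps that start
    at [x], each given by the vertices that follow [x]. *)
Fixpoint walks (r : nat) (x : 'rV[int]_d) : seq (seq 'rV[int]_d) :=
  if r is r'.+1 then
    [seq (x + s) :: p | s <- unit_steps, p <- walks r' (x + s)]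
  else [:: [::]].

Lemma size_walks r x : size (walks r x) = ((d + d) ^ r)%N.
Proof.
elim: r x => [//|r IH] x /=; rewrite size_allpairs_dep.
rewrite (eq_map (g := fun=> ((d + d) ^ r)%N)); last by move=> s; exact: IH.
by rewrite sumnE big_map big_const_seq count_predT iter_addn_0 size_unit_steps
  mulnC expnS.
Qed.

Lemma mem_walks x p : path (@lattice_adjacent d) x p -> p \in walks (size p) x.
Proof.
elim: p x => [//|y p IH] x /= /andP[/lattice_adjacent_step[s hs ->] hp].
by apply/allpairsPdep; exists s, p; rewrite IH.
Qed.

Lemma path_edges_cons x y p :
  path_edges x (y :: p) = [fset x; y]%fset :: path_edges y p.
Proof. by []. Qed.

Lemma size_path_edges x p : size (path_edges x p) = size p.
Proof. by rewrite size_pairmap. Qed.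

Lemma mem_path_edges x p (e : {fset 'rV[int]_d}) z :
  e \in path_edges x p -> z \in e -> z \in x :: p.
Proof.
elim: p x => [//|y p IH] x; rewrite path_edges_cons inE => /orP[/eqP->|/IH h].
  by rewrite !inE => /orP[]->; rewrite ?orbT.
by move=> /h zp; rewrite in_cons zp orbT.
Qed.

Lemma uniq_path_edges x p : uniq (x :: p) -> uniq (path_edges x p).
Proof.
elim: p x => [//|y p IH] x; rewrite path_edges_cons => /andP[xp up] /=.
rewrite IH// andbT; apply: contra xp => /mem_path_edges; apply.
by rewrite !inE eqxx.
Qed.

Lemma path_edges_lattice x p e : path (@lattice_adjacent d) x p ->
  e \in path_edges x p -> lattice_edges e.
Proof.
elim: p x => [//|y p IH] x; rewrite path_edges_cons in_cons /= => /andP[xy yp].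
by move=> /orP[/eqP->|/IH]; [exists x, y|exact].
Qed.

Lemma lattice_adjacentC x y : lattice_adjacent x y = lattice_adjacent y x.
Proof. by congr (_ == _); apply: eq_bigr => i _; rewrite distrC. Qed.

Lemma lattice_adjacent_coord x y (i : 'I_d) :
  lattice_adjacent x y -> `|x ord0 i - y ord0 i| <= 1.
Proof. by move=> /eqP <-; rewrite (bigD1 i)//= lerDl sumr_ge0. Qed.

Lemma path_coord x p (i : 'I_d) : path (@lattice_adjacent d) x p ->
  `|x ord0 i - last x p ord0 i| <= (size p)%:Z.
Proof.
elim: p x => [|y p IH] x /=; first by rewrite subrr normr0.
move=> /andP[/(lattice_adjacent_coord i) h1 /IH h2].
have /le_trans := ler_distD (y ord0 i) (x ord0 i) (last y p ord0 i).
by apply; rewrite -[(size p).+1]add1n PoszD lerD.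
Qed.

Section PassageTime.
Variables (R : realType) (tau : {fset 'rV[int]_d} -> R).

Lemma passage_time_nil x : passage_time tau x [::] = 0.
Proof. by rewrite /passage_time big_nil. Qed.

Lemma passage_time_cons x y p :
  passage_time tau x (y :: p) = tau [fset x; y]%fset + passage_time tau y p.
Proof. by rewrite /passage_time path_edges_cons big_cons. Qed.

Lemma passage_time_rcons x y p : passage_time tau x (rcons p y) =
  passage_time tau x p + tau [fset last x p; y]%fset.
Proof.
elim: p x => [|z p IH] x /=.
  by rewrite passage_time_cons !passage_time_nil add0r addr0.
by rewrite !passage_time_cons IH addrA.
Qed.

Hypothesis tau0 : forall e, 0 <= tau e.

Lemma passage_time_ge0 x p : 0 <= passage_time tau x p.
Proof. by rewrite /passage_time big_seq sumr_ge0. Qed.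

(** Erasing the loops of a walk does not increase its passage time. *)
Lemma loop_erasure x p : path (@lattice_adjacent d) x p ->
  exists2 p', self_avoiding_path x (last x p) p' &
    passage_time tau x p' <= passage_time tau x p.
Proof.
elim: p x => [|y p IH] x /=; first by exists [::] => //;
  rewrite /self_avoiding_path /= eqxx.
move=> /andP[xy /IH[p' /and3P[yp' lp' up'] hp']].
rewrite passage_time_cons; have [xp|xp] := boolP (x \in y :: p'); last first.
  exists (y :: p'); first by rewrite /self_avoiding_path /= xy yp' lp' xp.
  by rewrite passage_time_cons lerD2l.
suff [p2 sp2 hp2] : exists2 p2, self_avoiding_path x (last y p) p2 &
    passage_time tau x p2 <= passage_time tau y p'.
  exists p2 => //; apply: (le_trans hp2); apply: (le_trans hp').
  by rewrite lerDr.
(* The path from [x] is the part of [p'] that follows the visit to [x]. *)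
move: xp up' yp' lp' {hp'}; elim: p' y {IH xy} (last y p) => [|z p' IH] y e.
  rewrite inE => /eqP -> _ _ lp'; exists [::] => //.
  by rewrite /self_avoiding_path /= lp'.
rewrite inE => /orP[/eqP->|zp] uz yp' lz.
  by exists (z :: p') => //; rewrite /self_avoiding_path yp' lz.
move: yp' uz; rewrite [path _ _ _]/= [uniq _]/= => /andP[_ yp'] /andP[_ uz].
have [p2 sp2 hp2] := IH z e zp uz yp' lz.
by exists p2 => //; rewrite passage_time_cons (le_trans hp2)// lerDr.
Qed.

End PassageTime.

End LatticePaths.

Section Axis.
Variable d : nat.
Hypothesis d0 : (0 < d)%N.
Local Notation axis := (@axis_point d).

Lemma axis_point0 : axis 0 = 0.
Proof. by apply/rowP => i; rewrite !mxE; case: ifP. Qed.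

Lemma axis_point_coord n : axis n ord0 (Ordinal d0) = n%:Z.
Proof. by rewrite mxE. Qed.

Lemma axis_point_inj : injective axis.
Proof.
move=> m n /(congr1 (fun x : 'rV[int]_d => x ord0 (Ordinal d0))).
by rewrite !axis_point_coord => -[].
Qed.

Lemma axis_point_adjacent n : lattice_adjacent (axis n) (axis n.+1).
Proof.
rewrite /lattice_adjacent (bigD1 (Ordinal d0))//= !axis_point_coord big1 =>
  [|i].
  by rewrite addr0 -addn1 PoszD opprD addrA subrr add0r normrN.
rewrite !mxE -val_eqE/= => /negbTE ->.
by rewrite subrr normr0.
Qed.

(** The edge joining the [n]-th and the [n+1]-st point of the first axis. *)
Definition axis_edge (n : nat) : {fset 'rV[int]_d} :=
  [fset axis n; axis n.+1]%fset.

(** The straight path from the origin to the [n]-th point of the first axis,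
    without its initial vertex. *)
Definition axis_path (n : nat) : seq 'rV[int]_d := map axis (iota 1 n).

Lemma size_axis_path n : size (axis_path n) = n.
Proof. by rewrite size_map size_iota. Qed.

Lemma axis_pathS n : axis_path n.+1 = rcons (axis_path n) (axis n.+1).
Proof. by rewrite /axis_path -[X in iota 1 X]addn1 iotaD map_cat cats1 add1n.
  Qed.

Lemma last_axis_path n : last 0 (axis_path n) = axis n.
Proof. by case: n => [|n]; rewrite ?axis_pathS ?last_rcons// axis_point0. Qed.

Lemma self_avoiding_axis_path n :
  self_avoiding_path 0 (axis n) (axis_path n).
Proof.
apply/and3P; split.
- elim: n => [//|n IH]; rewrite axis_pathS rcons_path IH/= last_axis_path.
  exact: axis_point_adjacent.
- by rewrite last_axis_path.
rewrite -axis_point0 -[_ :: _]/(map axis (iota 0 n.+1)).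
by rewrite map_inj_uniq ?iota_uniq//; exact: axis_point_inj.
Qed.

Lemma size_self_avoiding n p :
  self_avoiding_path 0 (axis n) p -> (n <= size p)%N.
Proof.
move=> /and3P[+ /eqP lp _] => /(path_coord (Ordinal d0)).
by rewrite lp axis_point_coord mxE sub0r normrN ger0_norm.
Qed.

Section FirstPassage.
Variables (R : realType) (tau : {fset 'rV[int]_d} -> R).

Lemma passage_time_axis n :
  passage_time tau 0 (axis_path n) = \sum_(i < n) tau (axis_edge i).
Proof.
elim: n => [|n IH]; first by rewrite passage_time_nil big_ord0.
by rewrite axis_pathS passage_time_rcons big_ord_recr/= IH last_axis_path.
Qed.

Lemma eq_first_passage_time (tau' : {fset 'rV[int]_d} -> R) n :
  (forall e, lattice_edges e -> tau e = tau' e) ->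
  first_passage_time tau n = first_passage_time tau' n.
Proof.
move=> h; congr inf; apply: eq_imagel => p /= /and3P[hp _ _].
rewrite /passage_time big_seq [RHS]big_seq; apply: eq_bigr => e he.
exact/h/(path_edges_lattice hp he).
Qed.

Hypothesis tau0 : forall e, 0 <= tau e.

Let passage_times n := [set passage_time tau 0 p |
  p in [set p | self_avoiding_path 0 (axis n) p]].

Let passage_times_neq0 n : passage_times n !=set0.
Proof.
by exists (passage_time tau 0 (axis_path n)), (axis_path n) => //;
  exact: self_avoiding_axis_path.
Qed.

Let passage_times_lbound n : lbound (passage_times n) 0.
Proof. by move=> _ [p _ <-]; exact: passage_time_ge0. Qed.

Lemma first_passage_time_ge n c :
  (forall p, self_avoiding_path 0 (axis n) p -> c <= passage_time tau 0 p) ->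
  c <= first_passage_time tau n.
Proof.
move=> h; apply: lb_le_inf; first exact: passage_times_neq0.
by move=> _ [p hp <-]; exact: h.
Qed.

Lemma first_passage_time_ge0 n : 0 <= first_passage_time tau n.
Proof. by apply: first_passage_time_ge => p _; exact: passage_time_ge0. Qed.

Lemma first_passage_time_le n p : self_avoiding_path 0 (axis n) p ->
  first_passage_time tau n <= passage_time tau 0 p.
Proof.
move=> hp; apply: ge_inf; last by exists p.
by exists 0; exact: passage_times_lbound.
Qed.

Lemma first_passage_time_walk_le n p :
  path (@lattice_adjacent d) 0 p -> last 0 p = axis n ->
  first_passage_time tau n <= passage_time tau 0 p.
Proof.
move=> /(loop_erasure tau0)[p' + hp'] hl; rewrite hl => hp.
exact: le_trans (first_passage_time_le hp) hp'.
Qed.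

Lemma first_passage_time_lt n c : first_passage_time tau n < c ->
  exists2 p, self_avoiding_path 0 (axis n) p & passage_time tau 0 p < c.
Proof.
move=> /inf_lt[|_ [p hp <-] hc]; last by exists p.
exact: passage_times_neq0.
Qed.

Lemma first_passage_time_step m n :
  lattice_adjacent (axis m) (axis n) -> first_passage_time tau n <=
  first_passage_time tau m + tau [fset axis m; axis n]%fset.
Proof.
move=> mn; rewrite -lerBlDr; apply: first_passage_time_ge => p /and3P[hp /eqP
  hl up].
rewrite lerBlDr -hl -passage_time_rcons; apply: first_passage_time_walk_le.
  by rewrite rcons_path hp/= hl.
by rewrite last_rcons.
Qed.

(** Extending a path along the axis by one edge, in either direction, compares
    consecutive first passage times. *)
Lemma first_passage_timeS n :
  `|first_passage_time tau n.+1 - first_passage_time tau n| <= tau (axis_edge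
    n).
Proof.
have h := axis_point_adjacent n.
rewrite ler_norml lerBlDl (first_passage_time_step h) andbT lerNl opprB lerBlDl.
rewrite /axis_edge fsetUC; apply: first_passage_time_step.
by rewrite lattice_adjacentC.
Qed.

Lemma first_passage_time_dist k m :
  `|first_passage_time tau (k + m) - first_passage_time tau k| <=
  \sum_(i < m) tau (axis_edge (k + i)).
Proof.
elim: m => [|m IH]; first by rewrite addn0 subrr normr0 big_ord0.
rewrite addnS big_ord_recr/= addrC.
apply: (le_trans (ler_distD (first_passage_time tau (k + m)) _ _)).
by rewrite lerD// first_passage_timeS.
Qed.

End FirstPassage.
End Axis.

(** * The Efron-Stein inequality *)

Section BoundedMeasurable.
Context {disp : measure_display} {T : measurableType disp} {R : realType}.

(** Bounded measurable real functions: a class closed under the ring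
    operations, all of whose members are integrable for a finite measure. *)
Definition bounded_measurable (f : T -> R) : Prop :=
  measurable_fun [set: T] f /\ exists c, forall x, `|f x| <= c.

Lemma bounded_measurable_integrable (mu : {measure set T -> \bar R}) f :
  (mu [set: T] < +oo)%E -> bounded_measurable f ->
  mu.-integrable [set: T] (EFin \o f).
Proof.
move=> muT [mf [c hc]]; apply: measurable_bounded_integrable => //.
exists c; split; first exact: num_real.
by move=> M cM x _; apply: (le_trans (hc x)); exact: ltW.
Qed.

Lemma bounded_measurableD f g : bounded_measurable f -> bounded_measurable g ->
  bounded_measurable (fun x => f x + g x).
Proof.
move=> [mf [a ha]] [mg [b hb]]; split; first exact: measurable_funD.
by exists (a + b) => x; apply: (le_trans (ler_normD _ _)); rewrite lerD.
Qed.

Lemma bounded_measurableB f g : bounded_measurable f -> bounded_measurable g ->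
  bounded_measurable (fun x => f x - g x).
Proof.
move=> [mf [a ha]] [mg [b hb]]; split; first exact: measurable_funB.
by exists (a + b) => x; apply: (le_trans (ler_normB _ _)); rewrite lerD.
Qed.

Lemma bounded_measurableM f g : bounded_measurable f -> bounded_measurable g ->
  bounded_measurable (fun x => f x * g x).
Proof.
move=> [mf [a ha]] [mg [b hb]]; split; first exact: measurable_funM.
by exists (a * b) => x; rewrite normrM ler_pM.
Qed.

Lemma bounded_measurable_max0 f : bounded_measurable f ->
  bounded_measurable (fun x => Num.max 0 (f x)).
Proof.
move=> [mf [a ha]]; split; first by apply: measurable_maxr => //;
  exact: measurable_cst.
exists a => x; apply: le_trans (ha x); rewrite /Num.max; case: ifPn => // _.
by rewrite normr0.
Qed.

End BoundedMeasurable.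

Section Mixing.
Variable R : realType.
Implicit Types (S : pred nat) (x y : nat -> R).

(** The sequence that follows [y] at the indices in [S] and [x] elsewhere. *)
Definition mix S x y : nat -> R := fun i => if S i then y i else x i.

(** [f] is a measurable function of the first [K] coordinates: composing it
    with a measurable family of coordinates gives a measurable function. *)
Definition coordinate_measurable (K : nat) (f : (nat -> R) -> R) : Prop :=
  forall (disp : measure_display) (D : measurableType disp) (g : nat -> D -> R),
  (forall i, (i < K)%N -> measurable_fun [set: D] (g i)) ->
  measurable_fun [set: D] (fun z => f (g ^~ z)).

(** The cylinders over rectangles in the first [K] coordinates of a pair of
    sequences. *)
Definition pair_rectangles (K : nat) : set (set ((nat -> R) * (nat -> R))) :=
  [set A | exists B C : nat -> set R,
    [/\ forall i, measurable (B i), forall i, measurable (C i) &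
    A = [set u | forall i, (i < K)%N -> B i (u.1 i) /\ C i (u.2 i)]]].

Lemma pair_rectangles_setI K : setI_closed (pair_rectangles K).
Proof.
move=> _ _ [B [C [mB mC ->]]] [B' [C' [mB' mC' ->]]].
exists (fun i => B i `&` B' i), (fun i => C i `&` C' i).
split=> [i|i|]; [exact: measurableI|exact: measurableI|].
apply/seteqP; split=> [u [h1 h2] i iK|u h].
  by have [? ?] := h1 i iK; have [? ?] := h2 i iK.
by split=> i iK; have [[? ?] [? ?]] := h i iK.
Qed.

Local Notation pair_seq K := (g_sigma_algebraType (pair_rectangles K)).

Lemma measurable_pair_seq1 K i : (i < K)%N ->
  measurable_fun [set: pair_seq K] (fun u : pair_seq K => u.1 i).
Proof.
move=> iK _ B mB; rewrite setTI; apply: sub_sigma_algebra.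
exists (fun j => if j == i then B else setT), (fun=> setT); split.
- by move=> j; case: ifP.
- by move=> j; exact: measurableT.
apply/seteqP; split=> [u /= hu j _|u /= /(_ i iK)[]]; last by rewrite eqxx.
by split=> //; case: eqP => // ->.
Qed.

Lemma measurable_pair_seq2 K i : (i < K)%N ->
  measurable_fun [set: pair_seq K] (fun u : pair_seq K => u.2 i).
Proof.
move=> iK _ B mB; rewrite setTI; apply: sub_sigma_algebra.
exists (fun=> setT), (fun j => if j == i then B else setT); split.
- by move=> j; exact: measurableT.
- by move=> j; case: ifP.
apply/seteqP; split=> [u /= hu j _|u /= /(_ i iK)[_]]; last by rewrite eqxx.
by split=> //; case: eqP => // ->.
Qed.

Lemma measurable_mix K i S : (i < K)%N ->
  measurable_fun [set: pair_seq K] (fun u : pair_seq K => mix S u.1 u.2 i).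
Proof.
move=> iK; rewrite /mix; case: (S i); first exact: measurable_pair_seq2.
exact: measurable_pair_seq1.
Qed.

End Mixing.
(** Pairs of real sequences, with the sigma-algebra generated by the first [K]
    coordinates of both. *)
Notation pair_seq R K := (g_sigma_algebraType (@pair_rectangles R K)).

Section EfronStein.
Context (disp : measure_display) (Omega : measurableType disp) (R : realType).
Variable P : probability Omega R.
Variable X : nat -> Omega -> R.
Hypothesis mX : forall i, measurable_fun [set: Omega] (X i).
Hypothesis iX : mutually_independent P X.

Let P2 : probability (Omega * Omega)%type R := (P \x P)%E.

Let P2fin : (P2 [set: Omega * Omega] < +oo)%E.
Proof. by rewrite probability_setT ltry. Qed.

(** The pair of sequences obtained from two independent copies of [X] by
    exchanging them at the indices in [S]. *)
Definition exchange S (z : Omega * Omega) : (nat -> R) * (nat -> R) :=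
  (mix S (X ^~ z.1) (X ^~ z.2), mix (predC S) (X ^~ z.1) (X ^~ z.2)).

Lemma measurable_rectangle K (B : nat -> set R) :
  (forall i, measurable (B i)) ->
  measurable [set w | forall i, (i < K)%N -> B i (X i w)].
Proof.
move=> mB; rewrite (_ : [set w | _] = \bigcap_(i < K) (X i @^-1` B i)).
  by apply: bigcap_measurableType => i _; rewrite -[X in measurable X]setTI;
    exact: mX.
by apply/seteqP; split=> w /= h i; exact: h.
Qed.

Lemma independent_rectangle K (B : nat -> set R) :
  (forall i, measurable (B i)) ->
  P [set w | forall i, (i < K)%N -> B i (X i w)] =
    (\prod_(i < K) P (X i @^-1` B i))%E.
Proof.
move=> mB; have := iX [fset i | i in iota 0 K]%fset mB.
rewrite big_imfset//= undup_id ?iota_uniq// -[in iota 0 K](subn0 K).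
rewrite -/(index_iota 0 K) big_mkord => <-; congr (P _).
apply/seteqP; split=> w /= h i.
  by rewrite /= !inE/= mem_index_iota => iK; exact: h.
by move=> iK; apply: h; rewrite /= !inE/= mem_index_iota.
Qed.

(** The preimage of a rectangle is a product, each factor of which constrains
    one of the two copies. *)
Lemma exchange_rectangle K S (B C : nat -> set R) :
  exchange S @^-1` [set u | forall i, (i < K)%N -> B i (u.1 i) /\ C i (u.2 i)] =
  [set w | forall i, (i < K)%N -> (if S i then C i else B i) (X i w)] `*`
  [set w | forall i, (i < K)%N -> (if S i then B i else C i) (X i w)].
Proof.
apply/seteqP; split=> [[w w'] /= h|[w w'] /= [h1 h2] i iK].
  split=> i iK; have /= := h i iK; rewrite /mix /=; by case: (S i) => -[].
have := h1 i iK; have := h2 i iK; rewrite /mix/=; by case: (S i).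
Qed.

Lemma measurable_exchange K S :
  measurable_fun [set: Omega * Omega] (exchange S : _ -> pair_seq R K).
Proof.
apply: (@measurability _ _ (Omega * Omega)%type (pair_seq R K) setT (exchange
  S) (@pair_rectangles R K)) => //.
move=> _ [_ [B [C [mB mC ->]]] <-]; rewrite setTI exchange_rectangle.
apply: measurableX.
  by apply: (@measurable_rectangle K (fun i => if S i then C i else B i)) => i;
    case: (S i).
by apply: (@measurable_rectangle K (fun i => if S i then B i else C i)) => i;
  case: (S i).
Qed.

(** Exchanging coordinates between two independent copies does not change
    their joint law: by independence, both laws give a rectangle the product
    of the marginal probabilities. *)
Lemma exchange_law K S (A : set (pair_seq R K)) : measurable A ->
  P2 (exchange S @^-1` A) = P2 (exchange pred0 @^-1` A).
Proof.
move=> mA.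
pose E S' : {RV P2 >-> pair_seq R K} := HB.pack (exchange S' : _ -> pair_seq R
  K)
  (isMeasurableFun.Build _ _ _ _ _ (@measurable_exchange K S')).
pose m1 : probability (pair_seq R K) R := distribution P2 (E S).
pose m2 : probability (pair_seq R K) R := distribution P2 (E pred0).
have GT : pair_rectangles K [set: (nat -> R) * (nat -> R)].
  by exists (fun=> setT), (fun=> setT); split => //; apply/seteqP; split.
suff : m1 A = m2 A by [].
apply: (@measure_unique _ R (pair_seq R K) (@pair_rectangles R K) (fun=> setT)
  _ _ _ _ m1 m2) => //.
- exact: pair_rectangles_setI.
- by rewrite bigcup_const//; exists 0%N.
- move=> _ [B [C [mB mC ->]]]; set D := [set u | _].
  change (P2 (exchange S @^-1` D) = P2 (exchange pred0 @^-1` D)).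
  rewrite /D !exchange_rectangle /P2 /=.
  have mBC S' i : measurable (if S' i then C i else B i) by case: (S' i).
  have mCB S' i : measurable (if S' i then B i else C i) by case: (S' i).
  have pX (B1 B2 : nat -> set R) : (forall i, measurable (B1 i)) ->
      (forall i, measurable (B2 i)) ->
      (P \x P)%E ([set w | forall i, (i < K)%N -> B1 i (X i w)] `*`
        [set w | forall i, (i < K)%N -> B2 i (X i w)]) =
      (\prod_(i < K) P (X i @^-1` B1 i) * \prod_(i < K) P (X i @^-1` B2 i))%E.
    move=> mB1 mB2; rewrite -!independent_rectangle//.
    by apply: product_measure1E; exact: measurable_rectangle.
  have /= -> := pX _ _ (mBC S) (mCB S); rewrite (pX B C mB mC).
  rewrite -!big_split/=; apply: eq_bigr => i _; case: (S i) => //.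
  by rewrite muleC.
Qed.

Lemma integral_exchange K S (G : pair_seq R K -> R) :
  bounded_measurable G ->
  \int[P2]_z G (exchange S z) = \int[P2]_z G (exchange pred0 z).
Proof.
move=> bG; congr fine.
have h S' : (\int[P2]_z (G (exchange S' z))%:E =
    \int[pushforward P2 (exchange S' : _ -> pair_seq R K)]_u (G u)%:E)%E.
  rewrite integral_pushforward//=; first exact: measurable_exchange.
  - by apply/measurable_EFinP; case: bG.
  - apply: (bounded_measurable_integrable (f := G \o (exchange S' : _ ->
    pair_seq R K))) => //.
    case: bG => mG [c hc]; split; last by exists c => x; exact: hc.
    by apply: measurableT_comp => //; exact: measurable_exchange.
pose E S' : {RV P2 >-> pair_seq R K} := HB.pack (exchange S' : _ -> pair_seq R
  K)
  (isMeasurableFun.Build _ _ _ _ _ (@measurable_exchange K S')).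
rewrite !h; apply: (@eq_measure_integral _ _ _ _ (distribution P2 (E pred0))
  (distribution P2 (E S))).
by move=> A mA _; exact: exchange_law.
Qed.

Lemma bounded_exchange K S (G : pair_seq R K -> R) : bounded_measurable G ->
  bounded_measurable (fun z => G (exchange S z)).
Proof.
case=> mG [c hc]; split; last by exists c => x; exact: hc.
apply: (measurableT_comp (f := G) (g := (exchange S : _ -> pair_seq R K))) =>
  //.
exact: measurable_exchange.
Qed.

Section Inequality.
Variables (K : nat) (f : (nat -> R) -> R) (c : R).
Hypothesis mf : coordinate_measurable K f.
Hypothesis f_dep : forall x y, (forall i, (i < K)%N -> x i = y i) -> f x = f y.
Hypothesis f_bound : forall x, 0 <= f x <= c.

(* The two copies of [X] are [X ^~ z.1] and [X ^~ z.2]; [F S] is [f] with the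
   coordinates in [S] resampled, and [L k] selects the first [k] of them. *)
Let F S (z : Omega * Omega) := f (mix S (X ^~ z.1) (X ^~ z.2)).
Let L (k : nat) : pred nat := fun i => (i < k)%N.
Let I (g : Omega * Omega -> R) : R := \int[P2]_z g z.
Let FU S (u : pair_seq R K) := f (mix S u.1 u.2).

Let bFU S : bounded_measurable (FU S).
Proof.
split; first by apply: mf => i iK; exact: measurable_mix.
exists c => u; rewrite ger0_norm; by case/andP: (f_bound (mix S u.1 u.2)).
Qed.

Let F_eq S S' : (forall i, (i < K)%N -> S i = S' i) -> F S = F S'.
Proof. by move=> h; apply/funext => z; apply: f_dep => i iK;
  rewrite /mix h. Qed.

Let FUexchange S S' z : FU S (exchange S' z) = F (fun i => S i (+) S' i) z.
Proof.
congr f; apply/funext => i; rewrite /mix/=.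
by case: (S i) => /=; rewrite /mix /=; case: (S' i).
Qed.

Let F0E S : F (fun i => S i (+) pred0 i) = F S.
Proof. by apply: F_eq => i _; rewrite addbF. Qed.

Let bF S : bounded_measurable (F S).
Proof.
have := bounded_exchange pred0 (bFU S).
by under [X in bounded_measurable X -> _]eq_fun do rewrite FUexchange F0E.
Qed.

Let intI g : bounded_measurable g -> P2.-integrable setT (EFin \o g).
Proof. exact: bounded_measurable_integrable. Qed.

Let ID g h : bounded_measurable g -> bounded_measurable h ->
  I (fun z => g z + h z) = I g + I h.
Proof. by move=> bg bh; apply: RintegralD => //; exact: intI. Qed.

Let IB g h : bounded_measurable g -> bounded_measurable h ->
  I (fun z => g z - h z) = I g - I h.
Proof. by move=> bg bh; apply: RintegralB => //; exact: intI. Qed.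

Let I_le g h : bounded_measurable g -> bounded_measurable h ->
  (forall z, g z <= h z) -> I g <= I h.
Proof. by move=> bg bh gh; apply: le_Rintegral => //; exact: intI. Qed.

(* The contribution of the [k]-th coordinate to the upper bound. *)
Let resampling (k : nat) : R :=
  I (fun z => Num.max 0 (F (pred1 k) z - F pred0 z) ^+ 2).

Let bsq (g : Omega * Omega -> R) : bounded_measurable g -> bounded_measurable
  (fun z => g z ^+ 2).
Proof.
move=> bg; rewrite (_ : (fun z => _) = (fun z => g z * g z)).
  exact: bounded_measurableM.
by apply/funext => z; rewrite expr2.
Qed.

(* The exchange of the coordinates in [S] turns the resampling of the [k]-th
   coordinate of [X] into the one of a partially resampled sequence. *)
Let exchange_square S k : (k < K)%N -> ~~ S k ->
  I (fun z => (F S z - F (fun i => S i || (i == k)) z) ^+ 2) =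
  I (fun z => (F pred0 z - F (pred1 k) z) ^+ 2).
Proof.
move=> kK Sk.
pose G (u : pair_seq R K) := (FU pred0 u - FU (pred1 k) u) * (FU pred0 u - FU
  (pred1 k) u).
have bG : bounded_measurable G.
  by apply: bounded_measurableM; apply: bounded_measurableB; exact: bFU.
have := integral_exchange S bG; rewrite /I.
under eq_Rintegral do rewrite /G !FUexchange.
under [in RHS]eq_Rintegral do rewrite /G !FUexchange !F0E -expr2.
move=> <-; apply: eq_Rintegral => z _; rewrite -expr2; congr ((_ - _) ^+ 2).
congr (F _ z); apply/funext => i /=; have [->|ik] := eqVneq i k.
  by rewrite (negbTE Sk).
by rewrite orbF.
Qed.

(* The increment due to resampling is symmetric, so its positive part carries
   half of its second moment. *)
Let square_resampling k :
  I (fun z => (F pred0 z - F (pred1 k) z) ^+ 2) = 2 * resampling k.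
Proof.
pose G (u : pair_seq R K) :=
  Num.max 0 (FU (pred1 k) u - FU pred0 u) * Num.max 0 (FU (pred1 k) u - FU
    pred0 u).
have bG : bounded_measurable G.
  by apply: bounded_measurableM; apply: bounded_measurable_max0;
    apply: bounded_measurableB; exact: bFU.
have := integral_exchange (pred1 k) bG.
under eq_Rintegral do rewrite /G !FUexchange.
under [in RHS]eq_Rintegral do rewrite /G !FUexchange !F0E -expr2.
rewrite -/(I _) -[RHS]/(resampling k) => h;
  rewrite mulr2n mulrDl mul1r -[X in X + _]h -ID; last 2 first.
- by apply: bounded_measurableM; apply: bounded_measurable_max0;
  apply: bounded_measurableB; exact: bF.
- by apply: bsq; apply: bounded_measurable_max0; apply: bounded_measurableB;
  exact: bF.
apply: eq_Rintegral => z _.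
have -> : F (fun i => pred1 k i (+) pred1 k i) z = F pred0 z.
  by congr (F _ z); apply/funext => i /=; case: (i == k).
have -> : F (fun i => pred0 i (+) pred1 k i) z = F (pred1 k) z.
  by congr (F _ z).
rewrite -expr2; have [h1|h1] := lerP (F (pred1 k) z) (F pred0 z).
  rewrite max_r ?subr_ge0// max_l ?subr_le0// expr0n/= addr0.
  by [].
rewrite max_l ?subr_le0 1?ltW// max_r ?subr_ge0 1?ltW// expr0n/= add0r.
by rewrite -sqrrN opprB.
Qed.

(* Exchanging the [k]-th coordinate antisymmetrizes the first factor; the
   product of the two increments is then bounded by the mean of their squares,
   which have the same integral. *)
Let step k : (k < K)%N ->
  I (fun z => F pred0 z * (F (L k) z - F (L k.+1) z)) <= resampling k.
Proof.
move=> kK; set a := I _.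
pose G (u : pair_seq R K) := FU pred0 u * (FU (L k) u - FU (L k.+1) u).
have bG : bounded_measurable G.
  by apply: bounded_measurableM; [|apply: bounded_measurableB]; exact: bFU.
have := integral_exchange (pred1 k) bG.
under eq_Rintegral do rewrite /G !FUexchange.
under [in RHS]eq_Rintegral do rewrite /G !FUexchange !F0E.
have -> : (fun i => L k i (+) pred1 k i) = L k.+1.
  by apply/funext => i; rewrite /L -[pred1 k i]/(i == k) [(i < k.+1)%N]ltnS [(i
    <= k)%N]leq_eqVlt; have [->|ik] := eqVneq i k; rewrite ?ltnn// ?addbF.
have -> : (fun i => L k.+1 i (+) pred1 k i) = L k.
  by apply/funext => i; rewrite /L -[pred1 k i]/(i == k) [(i < k.+1)%N]ltnS [(i
    <= k)%N]leq_eqVlt; have [->|ik] := eqVneq i k; rewrite ?ltnn// ?addbF.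
have -> : (fun i => pred0 i (+) pred1 k i) = pred1 k by [].
rewrite -/a => h.
have b1 : bounded_measurable (fun z => F pred0 z - F (pred1 k) z).
  by apply: bounded_measurableB; exact: bF.
have b2 : bounded_measurable (fun z => F (L k) z - F (L k.+1) z).
  by apply: bounded_measurableB; exact: bF.
have b3 : bounded_measurable (fun z => F (L k.+1) z - F (L k) z).
  by apply: bounded_measurableB; exact: bF.
have h2 : a + a = I (fun z => (F pred0 z - F (pred1 k) z) * (F (L k) z - F (L
  k.+1) z)).
  have {}h : I (fun z => F (pred1 k) z * (F (L k.+1) z - F (L k) z)) = a := h.
  rewrite -{2}h /a -ID; last 2 first.
  - exact: bounded_measurableM.
  - exact: bounded_measurableM.
  by apply: eq_Rintegral => z _; ring.
have h3 : 2 * (a + a) <= 2 * resampling k + 2 * resampling k.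
  rewrite -{1}(square_resampling k) -(square_resampling k).
  rewrite -[X in _ <= _ + X](@exchange_square (L k) k kK);
    last by rewrite /L ltnn.
  have -> : (fun i => L k i || (i == k)) = L k.+1.
    by apply/funext => i; rewrite /L [in RHS]ltnS [in RHS]leq_eqVlt orbC.
  rewrite -(ID (bsq b1) (bsq b2)).
  rewrite mulr2n mulrDl mul1r h2 -ID;
    [|exact: bounded_measurableM|exact: bounded_measurableM].
  apply: I_le.
  - by apply: bounded_measurableD; exact: bounded_measurableM.
  - by apply: bounded_measurableD; [exact: (bsq b1)|exact: (bsq b2)].
  - move=> z; rewrite -subr_ge0; set u := F _ _ - _; set v := _ - F (L k.+1) z.
    by rewrite (_ : _ - _ = (u - v) ^+ 2) ?sqr_ge0//; ring.
lra.
Qed.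

(** The Efron-Stein inequality for bounded functions of finitely many
    independent variables. The variance is the integral of
    [F pred0 * (F pred0 - F (L K))], which telescopes over the number of
    resampled coordinates. *)
Lemma efron_stein :
  \int[P]_w (f (X ^~ w) ^+ 2) - (\int[P]_w f (X ^~ w)) ^+ 2 <=
  \sum_(k < K) \int[P2]_z
    (Num.max 0 (f (mix (pred1 (k : nat)) (X ^~ z.1) (X ^~ z.2)) - f (X ^~ z.1))
      ^+ 2).
Proof.
have F0 z : F pred0 z = f (X ^~ z.1) by [].
have FK z : F (L K) z = f (X ^~ z.2).
  by apply: f_dep => i iK; rewrite /mix /L iK.
have mfX : measurable_fun [set: Omega] (fun w => f (X ^~ w)) by exact: mf.
have f0 x : 0 <= f x by case/andP: (f_bound x).
have bf : bounded_measurable (fun w => f (X ^~ w)).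
  by split=> //; exists c => x; rewrite ger0_norm//;
    case/andP: (f_bound (X^~ x)).
have P1 : (P [set: Omega] < +oo)%E by rewrite probability_setT ltry.
have h1 : I (fun z => F pred0 z * F pred0 z) = \int[P]_w (f (X ^~ w) ^+ 2).
  congr fine; rewrite /P2 fubini_tonelli1//=.
  - rewrite /fubini_F/=; apply: eq_integral => w _.
    under eq_integral do rewrite !F0/=.
    by rewrite integral_cst//= probability_setT mule1 expr2.
  - by apply/measurable_EFinP; apply: measurable_funM; case: (bF pred0).
  - by move=> z; rewrite lee_fin mulr_ge0// f0.
have h2 : I (fun z => F pred0 z * F (L K) z) = (\int[P]_w f (X ^~ w)) ^+ 2.
  rewrite /I /Rintegral /P2 fubini_tonelli1//=; last 2 first.
  - by apply/measurable_EFinP; apply: measurable_funM;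
    [case: (bF pred0)|case: (bF (L K))].
  - by move=> z; rewrite lee_fin mulr_ge0// f0.
  rewrite /fubini_F/=.
  transitivity (fine (\int[P]_w ((f (X ^~ w))%:E * \int[P]_w' (f (X ^~
    w'))%:E))%E).
    congr fine; apply: eq_integral => w _.
    under eq_integral do rewrite F0 FK/= EFinM.
    rewrite ge0_integralZl//.
    + exact/measurable_EFinP.
    + by move=> w' _; rewrite lee_fin.
    + by rewrite lee_fin.
  rewrite ge0_integralZr//; last 3 first.
  - exact/measurable_EFinP.
  - by move=> w' _; rewrite lee_fin.
  - by apply: integral_ge0 => w' _; rewrite lee_fin.
  have fi : (\int[P]_w (f (X ^~ w))%:E)%E \is a fin_num.
    by apply: integrable_fin_num => //; exact: bounded_measurable_integrable.
  by rewrite fineM// expr2.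
rewrite -h1 -h2.
have -> : I (fun z => F pred0 z * F pred0 z) - I (fun z => F pred0 z * F (L K)
  z) =
    \sum_(k < K) I (fun z => F pred0 z * (F (L k) z - F (L k.+1) z)).
  have bM k : bounded_measurable (fun z => F pred0 z * F (L k) z).
    by apply: bounded_measurableM; exact: bF.
  transitivity (\sum_(0 <= k < K) (- I (fun z => F pred0 z * F (L k.+1) z) -
                 - I (fun z => F pred0 z * F (L k) z))).
    by rewrite telescope_sumr// opprK addrC.
  rewrite big_mkord; apply: eq_bigr => k _; rewrite opprK addrC -IB//.
  by apply: eq_Rintegral => z _; rewrite mulrBr.
by apply: ler_sum => k _; exact: step.
Qed.

End Inequality.
End EfronStein.

(** * Paths of bounded length and their essential edges *)

Section Truncation.
Variables (d : nat) (R : realType) (idx : {fset 'rV[int]_d} -> nat).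
Hypothesis idx_inj : forall e e' : {fset 'rV[int]_d},
  lattice_edges e -> lattice_edges e' -> idx e = idx e' -> e = e'.
Local Notation axis := (@axis_point d).
Implicit Types (x y : nat -> R) (p : seq 'rV[int]_d) (k m n r : nat).

(** The edge weights read off a sequence of reals through the numbering [idx]
    of the edges, negative entries being replaced by 0. *)
Definition edge_weights x (e : {fset 'rV[int]_d}) : R := Num.max 0 (x (idx e)).

Lemma edge_weights_ge0 x e : 0 <= edge_weights x e.
Proof. by rewrite /edge_weights le_max lexx. Qed.

(** The self-avoiding paths from the origin to the [n]-th point of the first
    axis with at most [m] edges. *)
Definition short_paths m n : seq (seq 'rV[int]_d) :=
  [seq p <- flatten [seq walks r 0 | r <- iota 0 m.+1] |
    self_avoiding_path 0 (axis n) p].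

Lemma size_mem_walks r (z : 'rV[int]_d) p : p \in walks r z -> size p = r.
Proof.
elim: r z p => [|r IH] z p /=; first by rewrite inE => /eqP ->.
by move=> /allpairsPdep[s [p' [_ /IH <- ->]]].
Qed.

Lemma mem_short_paths m n p :
  (p \in short_paths m n) = self_avoiding_path 0 (axis n) p && (size p <= m)%N.
Proof.
rewrite mem_filter; apply: andb_id2l => /and3P[hp _ _].
apply/flatten_mapP/idP => [[r]|pm].
  by rewrite mem_iota add0n ltnS => rm /size_mem_walks ->.
by exists (size p); [rewrite mem_iota add0n ltnS|exact: mem_walks].
Qed.

(** The passage time between the origin and the [n]-th point of the first
    axis, restricted to the paths with at most [m] edges and truncated at the
    level [m]. *)
Definition truncated_time m n x : R :=
  \big[Num.min/m%:R]_(p <- short_paths m n) passage_time (edge_weights x) 0 p.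

Lemma truncated_time_le m n x p : p \in short_paths m n ->
  truncated_time m n x <= passage_time (edge_weights x) 0 p.
Proof.
rewrite /truncated_time; elim: (short_paths m n) => [//|a s IH].
rewrite big_cons ge_min inE => /orP[/eqP->|/IH ->]; first by rewrite lexx.
by rewrite orbT.
Qed.

Lemma truncated_time_bound m n x : 0 <= truncated_time m n x <= m%:R.
Proof.
rewrite /truncated_time; elim: (short_paths m n) => [|a s /andP[h1 h2]].
  by rewrite big_nil ler0n lexx.
rewrite big_cons le_min h1 ge_min h2 orbT !andbT.
exact/passage_time_ge0/edge_weights_ge0.
Qed.

Lemma truncated_time_attained m n x : truncated_time m n x < m%:R ->
  exists2 p, p \in short_paths m n &
    truncated_time m n x = passage_time (edge_weights x) 0 p.
Proof.
rewrite /truncated_time; elim: (short_paths m n) => [|a s IH].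
  by rewrite big_nil ltxx.
rewrite big_cons; set F := passage_time _ _ a; set G := \big[_/_]_(_ <- _) _.
rewrite /Num.min; case: ifP => [_ _|_ /IH[p ps pE]]; first by exists a;
  rewrite ?mem_head.
by exists p; rewrite // in_cons ps orbT.
Qed.

(** A strict upper bound for the numbers of the edges used by these paths. *)
Definition index_bound m n : nat :=
  (\max_(p <- short_paths m n) \max_(e <- path_edges 0 p) idx e).+1.

Lemma idx_bound m n p (e : {fset 'rV[int]_d}) : p \in short_paths m n ->
  e \in path_edges 0 p -> (idx e < index_bound m n)%N.
Proof.
move=> ps ep; rewrite ltnS; apply: leq_trans (leq_bigmax_seq _ ps isT).
exact: leq_bigmax_seq ep isT.
Qed.

Lemma truncated_time_dep m n x y :
  (forall i, (i < index_bound m n)%N -> x i = y i) ->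
  truncated_time m n x = truncated_time m n y.
Proof.
move=> xy; rewrite /truncated_time big_seq [RHS]big_seq; apply: eq_bigr => p ps.
rewrite /passage_time big_seq [RHS]big_seq; apply: eq_bigr => e ep.
by rewrite /edge_weights xy//; exact: idx_bound ep.
Qed.

Section Measurability.
Context (disp : measure_display) (D : measurableType disp) (g : nat -> D -> R).

Lemma measurable_passage_time p :
  (forall e, e \in path_edges 0 p -> measurable_fun [set: D] (g (idx e))) ->
  measurable_fun [set: D] (fun z => passage_time (edge_weights (g ^~ z)) 0 p).
Proof.
rewrite /passage_time; elim: (path_edges 0 p) => [|e s IH] h.
  by under eq_fun do rewrite big_nil; exact: measurable_cst.
under eq_fun do rewrite big_cons; apply: measurable_funD; last first.
  by apply: IH => e' e's; apply: h; rewrite in_cons e's orbT.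
by apply: measurable_maxr; [exact: measurable_cst|apply: h; rewrite mem_head].
Qed.

Lemma measurable_truncated_time m n :
  (forall i, (i < index_bound m n)%N -> measurable_fun [set: D] (g i)) ->
  measurable_fun [set: D] (fun z => truncated_time m n (g ^~ z)).
Proof.
move=> h; have h' p : p \in short_paths m n ->
    measurable_fun [set: D] (fun z => passage_time (edge_weights (g ^~ z)) 0 p).
  by move=> ps; apply: measurable_passage_time => e ep; apply: h;
    exact: idx_bound ep.
rewrite /truncated_time; elim: (short_paths m n) h' => [|p s IH] h'.
  by under eq_fun do rewrite big_nil; exact: measurable_cst.
under eq_fun do rewrite big_cons; apply: measurable_minr.
  by apply: h'; rewrite mem_head.
by apply: IH => p' ps'; apply: h'; rewrite in_cons ps' orbT.
Qed.

End Measurability.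

(** The edge numbered [k] lies on every path that realizes the truncated
    passage time, which is below the level of truncation. *)
Definition essential m n x k : bool :=
  (truncated_time m n x < m%:R) &&
  all (fun p => (truncated_time m n x < passage_time (edge_weights x) 0 p) ||
                has (fun e => idx e == k) (path_edges 0 p))
    (short_paths m n).

Lemma measurable_essential (disp : measure_display) (D : measurableType disp)
    (g : nat -> D -> R) m n k :
  (forall i, measurable_fun [set: D] (g i)) ->
  measurable_fun [set: D] (fun z => essential m n (g ^~ z) k).
Proof.
move=> mg; have mt := @measurable_truncated_time _ D g m n (fun i _ => mg i).
apply: measurable_and.
  by apply: measurable_fun_ltr => //; exact: measurable_cst.
elim: (short_paths m n) => [|p s IH] /=; first exact: measurable_cst.
apply: measurable_and => //; apply: measurable_or; last exact: measurable_cst.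
by apply: measurable_fun_ltr => //; exact: measurable_passage_time.
Qed.

(** Resampling one coordinate can increase the truncated passage time only if
    the edge is essential, and then by at most its new weight. *)
Lemma truncated_time_resample m n k x y :
  Num.max 0 (truncated_time m n (mix (pred1 k) x y) - truncated_time m n x) <=
  Num.max 0 (y k) * (essential m n x k)%:R.
Proof.
have pos : 0 <= Num.max 0 (y k) by rewrite le_max lexx.
have [ess|] := boolP (essential m n x k); last first.
  rewrite mulr0 ge_max lexx subr_le0 /= negb_and => /orP[|/allPn[p ps]].
    by rewrite -leNgt => /(le_trans _); apply;
      case/andP: (truncated_time_bound m n (mix (pred1 k) x y)).
  rewrite negb_or -leNgt => /andP[h /hasPn hk]; apply: le_trans h.
  apply: (le_trans (truncated_time_le _ ps)); rewrite le_eqVlt; apply/orP; left.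
  apply/eqP; rewrite /passage_time big_seq [RHS]big_seq; apply: eq_bigr => e ep.
  by rewrite /edge_weights /mix/= (negbTE (hk e ep)).
rewrite mulr1 ge_max pos lerBlDl/=;
  case/andP: ess => /truncated_time_attained[p ps fp] _.
apply: (le_trans (truncated_time_le _ ps)); rewrite fp.
move: (ps); rewrite mem_short_paths => /andP[/and3P[hp _ /uniq_path_edges up]
  _].
have {}hp e : e \in path_edges 0 p -> lattice_edges e by exact:
  path_edges_lattice.
rewrite /passage_time; elim: (path_edges 0 p) up hp => [|e s IH];
  first by rewrite !big_nil add0r.
move=> /= /andP[es us] hs; rewrite !big_cons.
have [ke|ke] := eqVneq (idx e) k.
  rewrite {1}/edge_weights /mix /= ke eqxx addrC lerD2r.
  rewrite (eq_big_seq (edge_weights x)) ?lerDr ?edge_weights_ge0// => e' e's.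
  rewrite /edge_weights; case: eqP => // ke'; move: es.
  by rewrite (idx_inj _ _ (etrans ke (esym ke'))) ?e's//; apply: hs;
    rewrite in_cons ?eqxx// e's orbT.
rewrite {1}/edge_weights /mix /= (negbTE ke) -/(edge_weights x e) -addrA lerD2l.
by apply: IH => // e' e's; apply: hs; rewrite in_cons e's orbT.
Qed.

(** The essential edges all lie on one optimal path, which visits no edge
    twice. *)
Lemma sum_essential m n x : truncated_time m n x < m%:R ->
  exists2 p, p \in short_paths m n /\
    truncated_time m n x = passage_time (edge_weights x) 0 p &
    (\sum_(k < index_bound m n) essential m n x k <= size p)%N.
Proof.
move=> /truncated_time_attained[p ps fp]; exists p => //.
have h k : essential m n x k -> k \in map idx (path_edges 0 p).
  move=> /andP[_ /allP/(_ _ ps)]; rewrite fp ltxx /= => /hasP[e ep /eqP <-].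
  exact: map_f.
rewrite -(size_path_edges 0 p) -(size_map idx).
have -> : (\sum_(k < index_bound m n) essential m n x k)%N =
    size [seq k <- iota 0 (index_bound m n) | essential m n x k].
  rewrite -(big_mkord xpredT (fun k => essential m n x k : nat)) /index_iota
    subn0.
  rewrite size_filter -sum1_count [RHS]big_mkcond; apply: eq_bigr => k _.
  by case: essential.
apply: uniq_leq_size; first by rewrite filter_uniq ?iota_uniq.
by move=> k; rewrite mem_filter => /andP[/h].
Qed.

End Truncation.

Lemma measurable_lt_cst (disp : measure_display) (T : measurableType disp)
    (R : realType) (f : T -> R) (c : R) :
  measurable_fun [set: T] f -> measurable [set w | f w < c].
Proof.
move=> mf; rewrite (_ : [set w | f w < c] = [set: T] `&` f @^-1` `]-oo,
  c[%classic).
  exact: mf.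
by rewrite setTI; apply/seteqP; split=> w /=; rewrite in_itv.
Qed.

Lemma measurable_ge_cst (disp : measure_display) (T : measurableType disp)
    (R : realType) (f : T -> R) (c : R) :
  measurable_fun [set: T] f -> measurable [set w | c <= f w].
Proof.
move=> mf; rewrite (_ : [set w | c <= f w] = ~` [set w | f w < c]).
  exact/measurableC/measurable_lt_cst.
by apply/seteqP; split=> w /=; rewrite leNgt => /negP.
Qed.

Section UnionBound.
Context (disp : measure_display) (Omega : measurableType disp) (R : realType).
Variable P : probability Omega R.
Variables (I : eqType) (A : I -> set Omega).

Lemma measurable_union_seq (s : seq I) : (forall i, i \in s -> measurable (A
  i)) ->
  measurable [set w | exists2 i, i \in s & A i w].
Proof.
elim: s => [|i s IH] mA.
  by rewrite (_ : [set w | _] = set0)//; apply/seteqP; split=> // w [].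
rewrite (_ : [set w | _] = A i `|` [set w | exists2 i, i \in s & A i w]).
  apply: measurableU; first by apply: mA; rewrite mem_head.
  by apply: IH => j js; apply: mA; rewrite in_cons js orbT.
apply/seteqP; split=> [w [j]|w [Aw|[j js Aw]]].
- by rewrite in_cons => /orP[/eqP->|js Aw]; [left|right; exists j].
- by exists i; rewrite ?mem_head.
- by exists j; rewrite // in_cons js orbT.
Qed.

Lemma union_bound_seq (s : seq I) (c : R) :
  (forall i, i \in s -> measurable (A i)) ->
  (forall i, i \in s -> (P (A i) <= c%:E)%E) ->
  (P [set w | exists2 i, i \in s & A i w] <= ((size s)%:R * c)%:E)%E.
Proof.
elim: s => [|i s IH] mA hA.
  rewrite (_ : [set w | _] = set0) ?measure0 ?mul0r//.
  by apply/seteqP; split=> // w [].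
rewrite (_ : [set w | _] = A i `|` [set w | exists2 i, i \in s & A i w]).
  have mA' j : j \in s -> measurable (A j).
    by move=> js; apply: mA; rewrite in_cons js orbT.
  apply: (le_trans (measureU2 P _ _)).
  - by apply: mA; rewrite mem_head.
  - exact: measurable_union_seq.
  rewrite /= -natr1 mulrDl mul1r addrC EFinD leeD//.
    by apply: IH => // j js; apply: hA; rewrite in_cons js orbT.
  by apply: hA; rewrite mem_head.
apply/seteqP; split=> [w [j]|w [Aw|[j js Aw]]].
- by rewrite in_cons => /orP[/eqP->|js Aw]; [left|right; exists j].
- by exists i; rewrite ?mem_head.
- by exists j; rewrite // in_cons js orbT.
Qed.

End UnionBound.

(** * Paths crossed too fast *)

Section FastPaths.
Context (disp : measure_display) (Omega : measurableType disp) (R : realType).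
Variable P : probability Omega R.
Variable X : nat -> Omega -> R.
Hypothesis mX : forall i, measurable_fun [set: Omega] (X i).
Hypothesis iX : mutually_independent P X.
Variables (d : nat) (idx : {fset 'rV[int]_d} -> nat).
Hypothesis d0 : (0 < d)%N.
Hypothesis idx_inj : forall e e' : {fset 'rV[int]_d},
  lattice_edges e -> lattice_edges e' -> idx e = idx e' -> e = e'.
Variable eps : R.
Hypothesis eps0 : 0 < eps.
Hypothesis few_small : forall i,
  (P [set w | (X i w < eps)%R] <= ((8 * d)%:R ^- 2)%:E)%E.

(* The event that all the edges in [s] have weight less than [eps]. *)
Let small (s : seq {fset 'rV[int]_d}) : set Omega :=
  [set w | forall e, e \in s -> X (idx e) w < eps].

Let measurable_small s : measurable (small s).
Proof.
rewrite /small; elim: s => [|e s IH].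
  by rewrite (_ : [set w | _] = setT)//; apply/seteqP; split=> // w _ e.
rewrite (_ : [set w | _] = [set w | X (idx e) w < eps] `&` small s).
  apply: measurableI => //; exact: measurable_lt_cst.
apply/seteqP; split=> [w h|w [h1 h2] e'].
  by split=> [|e' e's]; apply: h; rewrite in_cons ?eqxx// e's orbT.
by rewrite in_cons => /orP[/eqP->//|/h2].
Qed.

Let small_probability s : uniq s -> (forall e, e \in s -> lattice_edges e) ->
  (P (small s) <= ((8 * d)%:R ^- (2 * size s))%:E)%E.
Proof.
move=> us ls; set c : R := (8 * d)%:R^-1.
have c0 : 0 <= c by rewrite invr_ge0.
have ui : uniq (map idx s).
  by rewrite map_inj_in_uniq// => e e' /ls le /ls le' /idx_inj; exact.
have mB (i : nat) : measurable [set u : R | u < eps].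
  exact: measurable_lt_cst.
have := iX [fset i | i in map idx s]%fset mB.
rewrite big_imfset//= undup_id//.
have -> : \bigcap_(i in [set` [fset i | i in map idx s]%fset]) X i @^-1` [set u
  | u < eps] = small s.
  apply/seteqP; split=> w /= h.
    by move=> e es; apply: (h (idx e)); rewrite /= !inE/=; exact: map_f.
  by move=> i /=; rewrite !inE /= => /mapP[e es ->]; exact: h.
move=> ->; rewrite -exprVn -/c exprM -(size_map idx).
elim: (map idx s) => [|i t IH]; first by rewrite big_nil expr0.
rewrite /= big_cons exprS EFinM lee_pmul//.
- by apply: prode_ge0 => j _; exact: measure_ge0.
- by rewrite /c exprVn; exact: few_small.
Qed.

(** Some self-avoiding path with [r] edges from the origin is crossed in time
    less than [eps / 2] per edge. *)
Definition fast_path r : set Omega := [set w | exists p,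
  [/\ path (@lattice_adjacent d) 0 p, uniq (0 :: p), size p = r &
    passage_time (edge_weights idx (X ^~ w)) 0 p < eps / 2 * r%:R]].

Lemma measurable_fast_path r : measurable (fast_path r).
Proof.
pose s := [seq p <- walks r (0 : 'rV[int]_d) | path (@lattice_adjacent d) 0 p
  && uniq (0 :: p)].
rewrite (_ : fast_path r = [set w | exists2 p, p \in s &
    passage_time (edge_weights idx (X ^~ w)) 0 p < eps / 2 * r%:R]).
  apply: measurable_union_seq => p _; apply: measurable_lt_cst.
  exact: (measurable_passage_time (fun e _ => mX (idx e))).
apply/seteqP; split=> [w [p [hp up sp hT]]|w [p + hT]].
  by exists p => //; rewrite mem_filter hp up -sp mem_walks.
by rewrite mem_filter => /andP[/andP[hp up] /size_mem_walks sp]; exists p.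
Qed.

(* A path crossed in time less than [eps / 2] per edge has at least half of
   its edges of weight less than [eps]. *)
Let many_small x p (b := [seq x (idx e) < eps | e <- path_edges 0 p]) :
  passage_time (edge_weights idx x) 0 p < eps / 2 * (size p)%:R ->
  (size p <= 2 * count id b)%N.
Proof.
have h : eps * ((size p)%:R - (count id b)%:R) <= passage_time (edge_weights
  idx x) 0 p.
  rewrite -(size_path_edges 0 p) /b /passage_time.
  elim: (path_edges 0 p) => [|e s IH] /=; first by rewrite big_nil subrr mulr0.
  rewrite big_cons -[(size s).+1]addn1 !natrD.
  have := edge_weights_ge0 idx x e.
  set A := (size s)%:R in IH *; set B := (count _ _)%:R in IH *.
  have [xe|xe] := ltrP (x (idx e)) eps; first by rewrite mulr1n; lra.
  have : eps <= edge_weights idx x e by rewrite le_max xe orbT.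
  by rewrite mulr0n; lra.
move=> /(le_lt_trans h); rewrite mulrAC -mulrA (ltr_pM2l eps0) => {}h.
by rewrite -(ler_nat R) natrM; lra.
Qed.

(** A union bound over the [(2 * d) ^ r] walks and the [2 ^ r] subsets of their
    edges with at least [r / 2] elements: each term is at most
    [((8 * d) ^- 2) ^ (r / 2)]. *)
Lemma fast_path_probability r : (P (fast_path r) <= (2 ^- r)%:E)%E.
Proof.
pose s1 := [seq p <- walks r (0 : 'rV[int]_d) | path (@lattice_adjacent d) 0 p
  && uniq (0 :: p)].
pose s2 := [seq b <- [seq val b | b <- enum {: r.-tuple bool}] | (r <= 2 *
  count id b)%N].
pose s := [seq (p, b) | p <- s1, b <- s2].
pose A (i : seq 'rV[int]_d * bitseq) := small (mask i.2 (path_edges 0 i.1)).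
have ss : (size s <= (d + d) ^ r * 2 ^ r)%N.
  rewrite size_allpairs leq_mul// size_filter.
    by rewrite (leq_trans (count_size _ _))// size_walks.
  by rewrite (leq_trans (count_size _ _))// size_map -cardE card_tuple
    card_bool.
have d8 : 0 < (8 * d)%:R :> R by rewrite ltr0n muln_gt0 d0.
have hsub : fast_path r `<=` [set w | exists2 i, i \in s & A i w].
  move=> w [p [hp up sp]]; rewrite -sp => /(@many_small (X ^~ w)); rewrite sp.
  set b := [seq _ | _ <- _] => hb.
  have sb : size b == r by rewrite size_map size_path_edges sp.
  exists (p, b).
    apply/allpairsP; exists (p, b); split => //=.
      by rewrite mem_filter hp up -sp mem_walks.
    rewrite mem_filter hb/=; apply/mapP; exists (Tuple sb) => //.
    by rewrite mem_enum.
  move=> e /=; rewrite -filter_mask mem_filter => /andP[].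
  by [].
apply: (@le_trans _ _ (P [set w | exists2 i, i \in s & A i w])).
  apply: le_measure; rewrite ?inE//; first exact: measurable_fast_path.
  by apply: measurable_union_seq => i _; exact: measurable_small.
apply: (@le_trans _ _ ((size s)%:R * (8 * d)%:R ^- r)%:E).
  apply: union_bound_seq => [i _|[p b] /allpairsP[[p' b'] [/= + + [-> ->]]]].
    exact: measurable_small.
  rewrite !mem_filter => /andP[/andP[hp up] pw] /andP[hb /mapP[b2 _ b2E]].
  have sb : size b' = r by rewrite b2E size_tuple.
  have sp := size_mem_walks pw.
  apply: (le_trans (small_probability _ _)).
  - by rewrite mask_uniq// uniq_path_edges.
  - by move=> e /mem_mask; exact: path_edges_lattice.
  rewrite lee_fin lef_pV2 ?posrE ?exprn_gt0// size_mask ?size_path_edges ?sb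
    ?sp//.
  by rewrite ler_weXn2l// ler1n muln_gt0 d0.
rewrite lee_fin; apply: (@le_trans _ _ ((((d + d) ^ r * 2 ^ r)%N)%:R * (8 *
  d)%:R ^- r)).
  by rewrite ler_wpM2r ?invr_ge0 ?exprn_ge0// ler_nat.
rewrite -expnMn natrX -expr_div_n -exprVn (_ : _ / _ = 2^-1)//.
have dR : d%:R != 0 :> R by rewrite pnatr_eq0 -lt0n.
by rewrite natrM natrD natrM; field.
Qed.

End FastPaths.

(** * The variance of the first passage time *)

Lemma sqr_sum_le (R : realType) (n : nat) (a : nat -> R) :
  (\sum_(i < n) a i) ^+ 2 <= n%:R * \sum_(i < n) a i ^+ 2.
Proof.
elim: n => [|n IH]; first by rewrite !big_ord0 expr0n/= mul0r.
rewrite !big_ord_recr/=; set s := \sum_(_ < n) a _ in IH *.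
set Q := \sum_(_ < n) _ ^+ 2 in IH *.
have h : 2 * s * a n <= Q + n%:R * a n ^+ 2.
  rewrite /Q /s mulr_sumr mulr_suml.
  have -> : n%:R * a n ^+ 2 = \sum_(i < n) a n ^+ 2 by rewrite sumr_const
    card_ord mulr_natl.
  rewrite -big_split/=; apply: ler_sum => i _.
  by rewrite -subr_ge0 (_ : _ - _ = (a i - a n) ^+ 2) ?sqr_ge0//; ring.
by rewrite sqrrD -natr1; lra.
Qed.

Lemma sum_geometric_weights (R : realType) (n : nat) :
  \sum_(r < n) (r%:R * 2 ^- r) <= 2 :> R.
Proof.
suff -> : \sum_(r < n) (r%:R * 2 ^- r) = 2 - 2 * (n.+1)%:R * 2 ^- n :> R.
  by rewrite gerBl mulr_ge0 ?mulr_ge0 ?invr_ge0 ?exprn_ge0.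
elim: n => [|n IH]; first by rewrite big_ord0 expr0 invr1 !mulr1 subrr.
rewrite big_ord_recr/= IH exprS invfM -!natr1.
by field; rewrite expf_neq0.
Qed.

Section Model.
Context (disp : measure_display) (Omega : measurableType disp) (R : realType).
Variable P : probability Omega R.
Variable X : nat -> Omega -> R.
Hypothesis mX : forall i, measurable_fun [set: Omega] (X i).
Hypothesis iX : mutually_independent P X.
Variables (d : nat) (idx : {fset 'rV[int]_d} -> nat).
Hypothesis d0 : (0 < d)%N.
Hypothesis idx_inj : forall e e' : {fset 'rV[int]_d},
  lattice_edges e -> lattice_edges e' -> idx e = idx e' -> e = e'.
Variable eps : R.
Hypothesis eps0 : 0 < eps.
Hypothesis few_small : forall i,
  (P [set w | (X i w < eps)%R] <= ((8 * d)%:R ^- 2)%:E)%E.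
Variable M2 : R.
Hypothesis second_moment : forall i, (\int[P]_w (X i w ^+ 2)%:E <= M2%:E)%E.

Local Notation axis := (@axis_point d).
Local Notation tau w := (edge_weights idx (X ^~ w)).

Let T (n : nat) (w : Omega) : R := first_passage_time (tau w) n.

(** The passage time of the segment of the first axis between its [k]-th and
    its [k+m]-th points. *)
Definition segment_time (k m : nat) (w : Omega) : R :=
  \sum_(i < m) tau w (axis_edge d (k + i)).
Local Notation S := segment_time.

Let tau0 w e : 0 <= tau w e. Proof. exact: edge_weights_ge0. Qed.

Lemma second_moment_ge0 : 0 <= M2.
Proof.
rewrite -lee_fin; apply: le_trans (second_moment 0).
by apply: integral_ge0 => w _; rewrite lee_fin sqr_ge0.
Qed.
Let M20 := second_moment_ge0.

Lemma measurable_edge_weights e : measurable_fun [set: Omega] (fun w => tau w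
  e).
Proof. by apply: measurable_maxr => //; exact: measurable_cst. Qed.

Lemma segment_time_ge0 k m w : 0 <= S k m w.
Proof. by apply: sumr_ge0 => i _. Qed.

Lemma measurable_segment_time k m : measurable_fun [set: Omega] (S k m).
Proof.
elim: m => [|m IH].
  rewrite (_ : S k 0 = cst 0); first exact: measurable_cst.
  by apply/funext => w; rewrite /S big_ord0.
rewrite (_ : S k m.+1 = fun w => S k m w + tau w (axis_edge d (k + m))).
  by apply: measurable_funD => //; exact: measurable_edge_weights.
by apply/funext => w; rewrite /S big_ord_recr.
Qed.

Let edge_weights_sqr_le w e : tau w e ^+ 2 <= X (idx e) w ^+ 2.
Proof.
rewrite /edge_weights /Num.max; case: ifP => // _.
by rewrite expr0n sqr_ge0.
Qed.

Let integral_sqr_edge_weights e : (\int[P]_w (tau w e ^+ 2)%:E <= M2%:E)%E.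
Proof.
apply: le_trans (second_moment (idx e)); apply: ge0_le_integral => //.
- by move=> w _; rewrite lee_fin sqr_ge0.
- by apply/measurable_EFinP; apply: measurable_funX;
  exact: measurable_edge_weights.
- by apply/measurable_EFinP; apply: measurable_funX.
- by move=> w _; rewrite lee_fin.
Qed.

Let integral_edge_weights e : (\int[P]_w (tau w e)%:E <= (1 + M2)%:E)%E.
Proof.
apply: (@le_trans _ _ (\int[P]_w (1 + (tau w e ^+ 2)%:E)%E)%E).
  apply: ge0_le_integral => //.
  - by move=> w _; rewrite lee_fin.
  - by apply/measurable_EFinP; exact: measurable_edge_weights.
  - apply: emeasurable_funD; first exact: measurable_cst.
    by apply/measurable_EFinP; apply: measurable_funX;
      exact: measurable_edge_weights.
  - move=> w _; rewrite -EFinD lee_fin -subr_ge0.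
    have -> : 1 + tau w e ^+ 2 - tau w e = (tau w e - 1) ^+ 2 + tau w e by ring.
    by rewrite addr_ge0// sqr_ge0.
rewrite ge0_integralD//.
- by rewrite integral_cst//= probability_setT mule1 EFinD leeD2l.
- by move=> w _; rewrite lee_fin sqr_ge0.
- by apply/measurable_EFinP; apply: measurable_funX;
  exact: measurable_edge_weights.
Qed.

Lemma integral_segment_time k m :
  (\int[P]_w (S k m w)%:E <= ((1 + M2) * m%:R)%:E)%E.
Proof.
rewrite /S; under eq_integral do rewrite -sumEFin.
rewrite ge0_integral_sum//; last 2 first.
- by move=> i; apply/measurable_EFinP; exact: measurable_edge_weights.
- by move=> i w _; rewrite lee_fin.
elim: m => [|m IH]; first by rewrite big_ord0 mulr0.
by rewrite big_ord_recr/= -natr1 mulrDr mulr1 EFinD leeD//;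
  exact: integral_edge_weights.
Qed.

Lemma integral_sqr_segment_time k m :
  (\int[P]_w (S k m w ^+ 2)%:E <= (M2 * m%:R ^+ 2)%:E)%E.
Proof.
apply: (@le_trans _ _ (\int[P]_w (m%:R%:E * \sum_(i < m) (tau w (axis_edge d (k
  + i)) ^+ 2)%:E))%E).
  apply: ge0_le_integral => //.
  - by move=> w _; rewrite lee_fin sqr_ge0.
  - by apply/measurable_EFinP; apply: measurable_funX;
    exact: measurable_segment_time.
  - apply: measurable_funeM; apply: emeasurable_sum => i.
    by apply/measurable_EFinP; apply: measurable_funX;
      exact: measurable_edge_weights.
  - move=> w _; rewrite sumEFin -EFinM lee_fin.
    exact: (sqr_sum_le m (fun i => tau w (axis_edge d (k + i)))).
rewrite ge0_integralZl//; last 2 first.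
- apply: emeasurable_sum => i.
  by apply/measurable_EFinP; apply: measurable_funX;
    exact: measurable_edge_weights.
- by move=> w _; apply: sume_ge0 => i _; rewrite lee_fin sqr_ge0.
rewrite ge0_integral_sum//; last 2 first.
- by move=> i; apply/measurable_EFinP; apply: measurable_funX;
  exact: measurable_edge_weights.
- by move=> i w _; rewrite lee_fin sqr_ge0.
rewrite expr2 mulrCA EFinM lee_pmul ?lee_fin//.
  by apply: sume_ge0 => i _; apply: integral_ge0 => w _;
    rewrite lee_fin sqr_ge0.
elim: m => [|m IH]; first by rewrite big_ord0 mulr0.
by rewrite big_ord_recr/= -natr1 mulrDr mulr1 EFinD leeD//;
  exact: integral_sqr_edge_weights.
Qed.

Lemma first_passage_time_le_segment n w : T n w <= S 0 n w.
Proof.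
apply: (le_trans (first_passage_time_le (tau0 w) (self_avoiding_axis_path d0
  n))).
by rewrite passage_time_axis.
Qed.

Section TruncatedVariance.
Variables (m n : nat).
Hypothesis nm : (n <= m)%N.
Let f : (nat -> R) -> R := truncated_time idx m n.
Let K := index_bound idx m n.
Let ess (k : nat) (w : Omega) : R := (essential idx m n (X ^~ w) k)%:R.
Let beta : R := eps / 2.

Let beta0 : 0 < beta. Proof. by rewrite divr_gt0. Qed.

Let mess k : measurable_fun [set: Omega] (ess k).
Proof.
rewrite (_ : ess k = fun w => if essential idx m n (X ^~ w) k then 1 else 0).
  apply: measurable_fun_ifT; [|exact: measurable_cst|exact: measurable_cst].
  exact: measurable_essential.
by apply/funext => w; rewrite /ess; case: essential.
Qed.

Lemma truncated_time_le_segment w : f (X ^~ w) <= S 0 n w.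
Proof.
have -> : S 0 n w = passage_time (tau w) 0 (axis_path d n) by rewrite
  passage_time_axis.
apply: truncated_time_le.
by rewrite mem_short_paths self_avoiding_axis_path// size_axis_path.
Qed.

Lemma measurable_truncated : measurable_fun [set: Omega] (fun w => f (X ^~ w)).
Proof. exact: (measurable_truncated_time (fun i _ => mX i)). Qed.

(* The number of essential edges is at most the length of an optimal path;
   either that path is slow enough for its length to be bounded through its
   passage time, or it is one of the exceptional fast paths. *)
Let sum_ess_le w : \sum_(k < K) ess k w <=
  beta^-1 * S 0 n w + \sum_(r < m.+1) r%:R * \1_(fast_path X idx eps r) w.
Proof.
have fast0 : 0 <= \sum_(r < m.+1) r%:R * \1_(fast_path X idx eps r) w :> R.
  by apply: sumr_ge0 => r _; rewrite mulr_ge0.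
have [fm|fm] := ltrP (f (X ^~ w)) m%:R; last first.
  rewrite big1 => [|k _]; last by rewrite /ess /essential -/f ltNge fm.
  by rewrite addr_ge0// mulr_ge0 ?invr_ge0 ?segment_time_ge0// ltW.
have [p [ps fp] hp] := sum_essential fm.
apply: (@le_trans _ _ (size p)%:R).
  by rewrite /ess -natr_sum ler_nat.
have fS : passage_time (tau w) 0 p <= S 0 n w.
  by rewrite -fp; exact: truncated_time_le_segment.
move: ps; rewrite mem_short_paths => /andP[/and3P[pp _ up] pm].
have [hT|hT] := ltrP (passage_time (tau w) 0 p) (beta * (size p)%:R).
  rewrite -[leLHS]add0r lerD//.
    by rewrite mulr_ge0 ?invr_ge0 ?segment_time_ge0// ltW.
  rewrite (bigD1 (Ordinal (n := m.+1) (m := size p) pm))//= indicE mem_set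
    ?mulr1; last by exists p.
  by rewrite lerDl; apply: sumr_ge0 => r _; rewrite mulr_ge0.
rewrite -[leLHS]addr0 lerD// ler_pdivlMl//.
exact: le_trans fS.
Qed.

(* The weight that replaces the one of the [k]-th edge is independent of the
   event that this edge is essential. *)
Let resample_le k : (\int[P \x P]_z ((Num.max 0
    (f (mix (pred1 k) (X ^~ z.1) (X ^~ z.2)) - f (X ^~ z.1)) ^+ 2)%:E) <=
  M2%:E * \int[P]_w (ess k w)%:E)%E.
Proof.
have m1 i : measurable_fun [set: Omega * Omega] (fun z : Omega * Omega => X i
  z.1).
  by apply: (measurableT_comp (mX i)); exact: measurable_fst.
have m2 i : measurable_fun [set: Omega * Omega] (fun z : Omega * Omega => X i
  z.2).
  by apply: (measurableT_comp (mX i)); exact: measurable_snd.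
pose h (z : Omega * Omega) : \bar R := ((ess k z.1)%:E * (X k z.2 ^+ 2)%:E)%E.
have mh : measurable_fun [set: Omega * Omega] h.
  apply/measurable_EFinP; apply: measurable_funM; last exact: measurable_funX.
  exact: (measurableT_comp (mess k) measurable_fst).
have h0 z : (0 <= h z)%E by rewrite mule_ge0// lee_fin ?sqr_ge0.
apply: (@le_trans _ _ (\int[P \x P]_z h z)%E).
  apply: ge0_le_integral => //.
  - by move=> z _; rewrite lee_fin sqr_ge0.
  - apply/measurable_EFinP; apply: measurable_funX; apply: measurable_maxr;
    first exact: measurable_cst.
    apply: measurable_funB; apply: measurable_truncated_time => i _ //.
    by rewrite /mix; case: (pred1 k i).
  - move=> z _; rewrite /h -EFinM lee_fin.
    have := truncated_time_resample idx_inj m n k (X ^~ z.1) (X ^~ z.2).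
    rewrite -/(ess k z.1) -/f => hr.
    apply: (@le_trans _ _ ((Num.max 0 (X k z.2) * ess k z.1) ^+ 2)).
      by rewrite lerXn2r// nnegrE ?le_max ?lexx// mulr_ge0// le_max lexx.
    rewrite exprMn mulrC ler_pM ?sqr_ge0//.
      by rewrite /ess; case: essential; rewrite ?expr1n// expr0n.
    by rewrite /Num.max; case: ifP => // _; rewrite expr0n sqr_ge0.
rewrite fubini_tonelli1// /fubini_F/=.
apply: (@le_trans _ _ (\int[P]_w (M2%:E * (ess k w)%:E))%E); last first.
  rewrite ge0_integralZl//; first exact/measurable_EFinP.
  - by move=> w _; rewrite lee_fin.
apply: ge0_le_integral => //.
- by move=> w _; apply: integral_ge0 => w' _; exact: h0.
- exact: measurable_fun_fubini_tonelli_F.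
- by apply: measurable_funeM; exact/measurable_EFinP.
move=> w _; have -> : (\int[P]_y h (w, y) = (ess k w)%:E * \int[P]_y (X k y ^+
  2)%:E)%E.
  rewrite -ge0_integralZl//.
  - by apply/measurable_EFinP; exact: measurable_funX.
  - by move=> w' _; rewrite lee_fin sqr_ge0.
  - by rewrite lee_fin.
by rewrite muleC lee_wpmul2r// lee_fin.
Qed.

(** By the Efron-Stein inequality, the variance is at most the second moment of
    a weight times the mean number of essential edges. *)
Lemma truncated_variance :
  \int[P]_w (f (X ^~ w) ^+ 2) - (\int[P]_w f (X ^~ w)) ^+ 2 <=
  M2 * (beta^-1 * ((1 + M2) * n%:R) + 2).
Proof.
have mf : coordinate_measurable K f.
  by move=> ? D g mg; exact: measurable_truncated_time.
have := efron_stein mX iX mf (@truncated_time_dep _ _ idx m n)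
  (truncated_time_bound idx m n).
move=> /le_trans; apply; rewrite -lee_fin -sumEFin.
have mS : measurable_fun [set: Omega] (fun w => (beta^-1)%:E * (S 0 n w)%:E)%E.
  by apply: measurable_funeM; apply/measurable_EFinP;
    exact: measurable_segment_time.
have mF r : measurable (fast_path X idx eps r) := measurable_fast_path mX idx
  eps r.
have mI r : measurable_fun [set: Omega] (fun w => (r%:R)%:E * (\1_(fast_path X
  idx eps r) w : R)%:E)%E.
  by apply: measurable_funeM; apply/measurable_EFinP; exact: measurable_indic.
apply: (@le_trans _ _ (\sum_(k < K) (M2%:E * \int[P]_w (ess k w)%:E))%E).
  apply: lee_sum => k _; rewrite fineK ?resample_le//.
  rewrite ge0_fin_numE; last by apply: integral_ge0 => z _;
    rewrite lee_fin sqr_ge0.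
  apply: (le_lt_trans (resample_le k)); rewrite lte_mul_pinfty ?lee_fin//.
  apply: (@le_lt_trans _ _ (\int[P]_w (cst 1 w))%E); last first.
    by rewrite integral_cst//= probability_setT mule1 ltry.
  apply: ge0_le_integral => //.
  - by move=> w _; rewrite lee_fin.
  - exact/measurable_EFinP.
  - by move=> w _; rewrite lee_fin /ess; case: essential.
rewrite -ge0_sume_distrr; last by move=> k _; apply: integral_ge0 => w _;
  rewrite lee_fin.
rewrite EFinM lee_pmul ?lee_fin//.
  by apply: sume_ge0 => k _; apply: integral_ge0 => w _; rewrite lee_fin.
rewrite -ge0_integral_sum//; last 2 first.
- by move=> k; exact/measurable_EFinP.
- by move=> k w _; rewrite lee_fin.
apply: (@le_trans _ _ (\int[P]_w ((beta^-1)%:E * (S 0 n w)%:E +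
    \sum_(r < m.+1) (r%:R)%:E * (\1_(fast_path X idx eps r) w)%:E))%E).
  apply: ge0_le_integral => //.
  - by move=> w _; apply: sume_ge0 => k _; rewrite lee_fin.
  - by apply: emeasurable_sum => k; exact/measurable_EFinP.
  - by apply: emeasurable_funD => //; apply: emeasurable_sum.
  - move=> w _; under [in leRHS]eq_bigr do rewrite -EFinM.
    by rewrite !sumEFin -EFinM -EFinD lee_fin.
rewrite ge0_integralD//; last 3 first.
- by move=> w _; rewrite -EFinM lee_fin mulr_ge0 ?invr_ge0 ?segment_time_ge0//
  ltW.
- by move=> w _; apply: sume_ge0 => r _; rewrite -EFinM lee_fin mulr_ge0.
- by apply: emeasurable_sum.
rewrite ge0_integralZl//; last 3 first.
- by apply/measurable_EFinP; exact: measurable_segment_time.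
- by move=> w _; rewrite lee_fin segment_time_ge0.
- by rewrite lee_fin invr_ge0 ltW.
rewrite EFinD EFinM leeD//.
  by rewrite lee_wpmul2l ?lee_fin ?invr_ge0 ?(ltW beta0)//;
    exact: integral_segment_time.
rewrite ge0_integral_sum//.
apply: (@le_trans _ _ (\sum_(r < m.+1) ((r : nat)%:R * 2 ^- r)%:E)%E);
  last first.
  by rewrite sumEFin lee_fin sum_geometric_weights.
apply: lee_sum => r _; rewrite ge0_integralZl//.
  rewrite integral_indic// setIT EFinM lee_wpmul2l ?lee_fin//.
  exact: fast_path_probability.
by apply/measurable_EFinP; exact: measurable_indic.
Qed.

End TruncatedVariance.

Let cvg_truncated n w :
  (fun m => truncated_time idx m n (X ^~ w)) @ \oo --> T n w.
Proof.
apply/cvgrPdist_lt => e e0.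
have : T n w < T n w + e by rewrite ltrDl.
move=> /(first_passage_time_lt d0)[p sp pT].
near=> m.
have pm : (size p <= m)%N by near: m; exact: nbhs_infty_ge.
have Tm : T n w <= m%:R by near: m; exact: nbhs_infty_ger.
have h1 : T n w <= truncated_time idx m n (X ^~ w).
  have [/truncated_time_attained[p' + ->]|h] := ltrP (truncated_time idx m n (X
    ^~ w)) m%:R.
    by rewrite mem_short_paths => /andP[sp' _]; exact: first_passage_time_le.
  exact: le_trans h.
have h2 : truncated_time idx m n (X ^~ w) < T n w + e.
  by apply: le_lt_trans pT; apply: truncated_time_le;
    rewrite mem_short_paths sp.
by rewrite distrC ger0_norm ?subr_ge0// ltrBlDl.
Unshelve. all: by end_near. Qed.

Lemma measurable_first_passage_weights n : measurable_fun [set: Omega] (T n).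
Proof.
apply: (@measurable_fun_cvg _ _ _ _ (fun m w => truncated_time idx m n (X ^~
  w))).
  by move=> m; exact: measurable_truncated.
by move=> w _; exact: cvg_truncated.
Qed.

Let T0 n w : 0 <= T n w. Proof. exact: first_passage_time_ge0. Qed.

Lemma integral_sqr_first_passage n : (\int[P]_w (T n w ^+ 2)%:E <= (M2 * n%:R
  ^+ 2)%:E)%E.
Proof.
apply: le_trans (integral_sqr_segment_time 0 n); apply: ge0_le_integral => //.
- by move=> w _; rewrite lee_fin sqr_ge0.
- by apply/measurable_EFinP; apply: measurable_funX;
  exact: measurable_first_passage_weights.
- by apply/measurable_EFinP; apply: measurable_funX;
  exact: measurable_segment_time.
- move=> w _; rewrite lee_fin lerXn2r ?nnegrE ?segment_time_ge0//.
  exact: first_passage_time_le_segment.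
Qed.

Lemma integral_first_passage n : (\int[P]_w (T n w)%:E <= ((1 + M2) *
  n%:R)%:E)%E.
Proof.
apply: le_trans (integral_segment_time 0 n); apply: ge0_le_integral => //.
- by move=> w _; rewrite lee_fin.
- by apply/measurable_EFinP; exact: measurable_first_passage_weights.
- by apply/measurable_EFinP; exact: measurable_segment_time.
- by move=> w _; rewrite lee_fin first_passage_time_le_segment.
Qed.

(** The bound on the variance of the truncated passage times passes to the limit
    by dominated convergence, the axis providing the dominating variable. *)
Lemma first_passage_variance n :
  \int[P]_w (T n w ^+ 2) - (\int[P]_w T n w) ^+ 2 <=
  M2 * ((eps / 2)^-1 * ((1 + M2) * n%:R) + 2).
Proof.
have mT := measurable_first_passage_weights n.
have mS := measurable_segment_time 0 n.
pose fm m w := truncated_time idx (m + n) n (X ^~ w).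
have mf m : measurable_fun [set: Omega] (fm m) by exact: measurable_truncated.
have fS m w : fm m w <= S 0 n w by apply: truncated_time_le_segment;
  exact: leq_addl.
have f0 m w : 0 <= fm m w by case/andP: (truncated_time_bound idx (m + n) n (X
  ^~ w)).
have fT w : (fun m => fm m w) @ \oo --> T n w.
  have := @cvg_truncated n w; rewrite -(cvg_shiftn n).
  exact.
have iS : P.-integrable setT (EFin \o S 0 n).
  apply/integrableP; split; first exact/measurable_EFinP.
  under eq_integral do rewrite gee0_abs ?lee_fin ?segment_time_ge0//.
  by apply: (le_lt_trans (integral_segment_time 0 n)); rewrite ltry.
have iS2 : P.-integrable setT (fun w => (S 0 n w ^+ 2)%:E).
  apply/integrableP; split; first by apply/measurable_EFinP;
    exact: measurable_funX.
  under eq_integral do rewrite gee0_abs ?lee_fin ?sqr_ge0//.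
  by apply: (le_lt_trans (integral_sqr_segment_time 0 n)); rewrite ltry.
have c1 : (fun m => \int[P]_w fm m w) @ \oo --> \int[P]_w T n w.
  have [] := @dominated_convergence _ _ R P setT measurableT
    (fun m w => (fm m w)%:E) (fun w => (T n w)%:E) (EFin \o S 0 n).
  - by move=> m; exact/measurable_EFinP.
  - exact/measurable_EFinP.
  - by apply: aeW => w _; apply: cvg_EFin; [exact: nearW|exact: fT].
  - exact: iS.
  - by apply: aeW => w m _; rewrite /= lee_fin ger0_norm.
  move=> iT _ h.
  apply: fine_cvg; rewrite fineK//.
  exact: (integrable_fin_num measurableT iT).
have c2 : (fun m => \int[P]_w (fm m w ^+ 2)) @ \oo --> \int[P]_w (T n w ^+ 2).
  have [] := @dominated_convergence _ _ R P setT measurableT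
    (fun m w => (fm m w ^+ 2)%:E) (fun w => (T n w ^+ 2)%:E) (fun w => (S 0 n w
      ^+ 2)%:E).
  - by move=> m; apply/measurable_EFinP; exact: measurable_funX.
  - by apply/measurable_EFinP; exact: measurable_funX.
  - apply: aeW => w _; apply: cvg_EFin; first exact: nearW.
    by under eq_fun do rewrite expr2; rewrite expr2; apply: cvgM; exact: fT.
  - exact: iS2.
  - apply: aeW => w m _; rewrite /= lee_fin ger0_norm ?sqr_ge0//.
    by rewrite lerXn2r ?nnegrE ?segment_time_ge0.
  move=> iT _ h; apply: fine_cvg; rewrite fineK//.
  exact: (integrable_fin_num measurableT iT).
have c3 : (fun m => \int[P]_w (fm m w ^+ 2) - (\int[P]_w fm m w) ^+ 2) @ \oo -->
    \int[P]_w (T n w ^+ 2) - (\int[P]_w T n w) ^+ 2.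
  by apply: cvgB => //; rewrite expr2; under eq_fun do rewrite expr2;
    exact: cvgM.
apply: (cvgr_to_le c3); apply: nearW => m.
by apply: truncated_variance; exact: leq_addl.
Qed.

End Model.

(** * Second moments, almost sure convergence and convergence in the mean *)

Lemma sqrt_bounds (n : nat) : exists k, (k ^ 2 <= n < k.+1 ^ 2)%N.
Proof.
elim: n => [|n [k /andP[h1 h2]]]; first by exists 0%N.
have [h|h] := ltnP n.+1 (k.+1 ^ 2); first by exists k; rewrite (leq_trans h1)//.
by exists k.+1; rewrite h /= (leq_ltn_trans h2)// ltn_exp2r.
Qed.

Lemma sum_inverse_squares (R : realType) (n : nat) :
  \sum_(k < n) (k.+1%:R ^- 2) <= 2 :> R.
Proof.
case: n => [|n]; first by rewrite big_ord0.
suff : \sum_(k < n.+1) (k.+1%:R ^- 2) <= 2 - n.+1%:R^-1 :> R.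
  by move=> /le_trans; apply; rewrite gerBl invr_ge0.
elim: n => [|n IH]; first by rewrite big_ord_recr big_ord0/= add0r expr1n
  !invr1 -[2]/(1 + 1) addrK.
rewrite big_ord_recr/=; apply: (le_trans (lerD IH (lexx _))).
have : n.+1%:R^-1 - n.+2%:R^-1 - n.+2%:R ^- 2 = (n.+1%:R * n.+2%:R ^+ 2)^-1 :>
  R.
  rewrite -[n.+2]addn1 natrD; have : 0 < n.+1%:R :> R by rewrite ltr0n.
  move: (n.+1%:R : R) => x x0; field.
  by rewrite !lt0r_neq0// addr_gt0.
have : 0 <= (n.+1%:R * n.+2%:R ^+ 2)^-1 :> R by rewrite invr_ge0 mulr_ge0.
move: (_ * _)^-1 n.+1%:R^-1 n.+2%:R^-1 (n.+2%:R ^- 2) => u x y z; lra.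
Qed.

Section SecondMoment.
Context (disp : measure_display) (Omega : measurableType disp) (R : realType).
Variable P : probability Omega R.
Implicit Types Y : Omega -> R.

Lemma markov_sqr Y (e : R) : measurable_fun [set: Omega] Y -> 0 < e ->
  (P [set w | (e <= `|Y w|)%R] <= (e ^- 2)%:E * \int[P]_w (Y w ^+ 2)%:E)%E.
Proof.
move=> mY e0; rewrite lee_pdivlMl ?exprn_gt0//.
have mA : measurable [set w | e <= `|Y w|].
  by apply: measurable_ge_cst; exact: measurableT_comp.
rewrite -[X in P X]setIT -(integral_indic P measurableT mA) -ge0_integralZl//;
  last 2 first.
- by apply/measurable_EFinP; exact: measurable_indic.
- by rewrite lee_fin sqr_ge0.
apply: ge0_le_integral => //.
- by move=> w _; rewrite -EFinM lee_fin mulr_ge0 ?sqr_ge0.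
- by apply: measurable_funeM; apply/measurable_EFinP; exact: measurable_indic.
- by apply/measurable_EFinP; exact: measurable_funX.
move=> w _; rewrite -EFinM lee_fin indicE; have [|] := boolP (w \in _).
  rewrite inE/= mulr1 => h; rewrite -[leRHS]real_normK ?num_real//.
  by rewrite lerXn2r// nnegrE// ltW.
by rewrite mulr0 sqr_ge0.
Qed.

Lemma sqr_integrable_integrable Y : measurable_fun [set: Omega] Y ->
  (\int[P]_w (Y w ^+ 2)%:E < +oo)%E -> P.-integrable [set: Omega] (EFin \o Y).
Proof.
move=> mY h; apply/integrableP; split; first exact/measurable_EFinP.
have mY2 : measurable_fun [set: Omega] (fun w => (Y w ^+ 2)%:E).
  by apply/measurable_EFinP; exact: measurable_funX.
apply: (@le_lt_trans _ _ (\int[P]_w (1 + (Y w ^+ 2)%:E)%E)%E).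
  apply: ge0_le_integral => //.
  - by do 2 apply: measurableT_comp => //.
  - exact: emeasurable_funD.
  move=> w _ /=; rewrite -EFinD lee_fin -[Y w ^+ 2]real_normK ?num_real//.
  have -> : 1 + `|Y w| ^+ 2 = `|Y w| + ((`|Y w| - 1) ^+ 2 + `|Y w|) by ring.
  by rewrite lerDl addr_ge0 ?sqr_ge0.
rewrite ge0_integralD//; last by move=> w _; rewrite lee_fin sqr_ge0.
by rewrite integral_cst//= probability_setT mule1 lte_add_pinfty ?ltry.
Qed.

Lemma sqr_integrable Y : measurable_fun [set: Omega] Y ->
  (\int[P]_w (Y w ^+ 2)%:E < +oo)%E ->
  P.-integrable [set: Omega] (EFin \o (fun w => Y w ^+ 2)).
Proof.
move=> mY h; apply/integrableP; split.
  by apply/measurable_EFinP; exact: measurable_funX.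
by under eq_integral do rewrite /= ger0_norm ?sqr_ge0//.
Qed.

Lemma centered_second_moment Y (m := \int[P]_w Y w) :
  measurable_fun [set: Omega] Y -> (\int[P]_w (Y w ^+ 2)%:E < +oo)%E ->
  (\int[P]_w ((Y w - m) ^+ 2)%:E = (\int[P]_w (Y w ^+ 2) - m ^+ 2)%:E)%E.
Proof.
move=> mY h; have i1 := sqr_integrable_integrable mY h.
have i2 := sqr_integrable mY h.
have i3 : P.-integrable [set: Omega] (EFin \o (fun w => (- 2 * m) * Y w)).
  have := integrableZl measurableT (- 2 * m) i1.
  by apply: eq_integrable => // w _; rewrite /= EFinM.
have i4 : P.-integrable [set: Omega] (EFin \o (fun=> m ^+ 2)).
  by apply: finite_measure_integrable_cst.
have i5 : P.-integrable [set: Omega] (EFin \o (fun w => - 2 * m * Y w + m ^+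
  2)).
  exact: (integrableD measurableT i3 i4).
have -> : (\int[P]_w ((Y w - m) ^+ 2)%:E)%E =
    (\int[P]_w (Y w ^+ 2 + (- 2 * m * Y w + m ^+ 2))%:E)%E.
  by apply: eq_integral => w _; congr EFin; ring.
rewrite -[LHS]fineK; last by apply: (integrable_fin_num measurableT);
  exact: (integrableD measurableT i2 i5).
rewrite -[fine _]/(\int[P]_w (Y w ^+ 2 + (- 2 * m * Y w + m ^+ 2))).
rewrite RintegralD// RintegralD// RintegralZl// Rintegral_cst//=
  probability_setT mulr1 -/m.
by congr EFin; ring.
Qed.

Lemma Lnorm2_le Y (e : R) : 0 <= e ->
  (\int[P]_w (Y w ^+ 2)%:E <= (e ^+ 2)%:E)%E -> ('N[P]_2%:E[EFin \o Y] <=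
    e%:E)%E.
Proof.
move=> e0 h.
have hN : ('N[P]_2%:E[EFin \o Y] `^ 2 = \int[P]_w (Y w ^+ 2)%:E)%E.
  rewrite poweR_Lnorm//; apply: eq_integral => w _.
  by rewrite /= powR_mulrn// real_normK// num_real.
have N0 : (0 <= 'N[P]_2%:E[EFin \o Y])%E by exact: Lnorm_ge0.
move: h; rewrite -hN; case: ('N[P]_2%:E[EFin \o Y])%E N0 => [r||]//.
  rewrite !lee_fin => r0; rewrite powR_mulrn// => h.
  by rewrite -(@ler_pXn2r _ 2)// nnegrE.
by rewrite poweRyr.
Qed.

(** The case [p = 1] rests on [2 * |y| <= e + y ^ 2 / e]. *)
Lemma Lnorm1_le Y (e : R) : measurable_fun [set: Omega] Y -> 0 < e ->
  (\int[P]_w (Y w ^+ 2)%:E <= (e ^+ 2)%:E)%E -> ('N[P]_1[EFin \o Y] <= e%:E)%E.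
Proof.
move=> mY e0 h; rewrite Lnorm1.
have mY2 : measurable_fun [set: Omega] (fun w => ((2 * e)^-1)%:E * (Y w ^+
  2)%:E)%E.
  by apply: measurable_funeM; apply/measurable_EFinP; exact: measurable_funX.
have pe : 0 <= (2 * e)^-1 by rewrite invr_ge0 mulr_ge0// ltW.
apply: (@le_trans _ _ (\int[P]_w ((e / 2)%:E + ((2 * e)^-1)%:E * (Y w ^+
  2)%:E)%E)%E).
  apply: ge0_le_integral => //.
  - by do 2 apply: measurableT_comp => //.
  - exact: emeasurable_funD.
  move=> w _ /=; rewrite -EFinM -EFinD lee_fin -[Y w ^+ 2]real_normK
    ?num_real//.
  rewrite -subr_ge0 (_ : _ - _ = (2 * e)^-1 * (`|Y w| - e) ^+ 2).
    by rewrite mulr_ge0 ?sqr_ge0.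
  by field; exact: lt0r_neq0.
rewrite ge0_integralD//; last 2 first.
- by move=> w _; rewrite lee_fin divr_ge0// ltW.
- by move=> w _; rewrite -EFinM lee_fin mulr_ge0 ?sqr_ge0.
rewrite integral_cst//= probability_setT mule1 ge0_integralZl//; last 2 first.
- by apply/measurable_EFinP; exact: measurable_funX.
- by move=> w _; rewrite lee_fin sqr_ge0.
apply: (@le_trans _ _ ((e / 2)%:E + ((2 * e)^-1)%:E * (e ^+ 2)%:E)%E).
  by rewrite leeD2l// lee_wpmul2l.
rewrite -EFinM -EFinD lee_fin le_eqVlt; apply/orP; left; apply/eqP.
by field; exact: lt0r_neq0.
Qed.

(** Convergence of the second moments to 0 gives convergence in [L^p] for
    [p = 1] and [p = 2]. *)
Lemma cvg_Lp_second_moment (Y : nat -> Omega -> R) (p : \bar R) (v : nat -> R) :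
  p = 1%:E \/ p = 2%:E ->
  (forall n, measurable_fun [set: Omega] (Y n)) ->
  (forall n, (\int[P]_w (Y n w ^+ 2)%:E <= (v n)%:E)%E) ->
  v n @[n --> \oo] --> (0 : R) -> cvg_Lp P p Y (cst 0).
Proof.
move=> hp mY hv v0.
have N_le n (e : R) : 0 < e -> v n <= e ^+ 2 -> ('N[P]_p[EFin \o Y n] <=
  e%:E)%E.
  move=> e0 ve; have h : (\int[P]_w (Y n w ^+ 2)%:E <= (e ^+ 2)%:E)%E.
    by apply: (le_trans (hv n)); rewrite lee_fin.
  by case: hp => ->; [exact: Lnorm1_le|apply: Lnorm2_le => //; exact: ltW].
have v_ge0 n : 0 <= v n.
  by rewrite -lee_fin; apply: le_trans (hv n); apply: integral_ge0 => w _;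
    rewrite lee_fin sqr_ge0.
split.
- move=> n; rewrite inE; apply/andP; split; first by rewrite inE/=; exact: mY.
  rewrite inE/= /finite_norm.
  apply: (@le_lt_trans _ _ (1 + v n)%:E); last exact: ltry.
  apply: N_le; first by rewrite ltr_wpDr.
  by rewrite -subr_ge0 (_ : _ - _ = 1 + v n + v n ^+ 2) ?addr_ge0 ?sqr_ge0//;
    ring.
- by case: hp => ->; exact: Lfun_cst.
have -> : (fun n => 'N[P]_p[EFin \o (Y n \- cst 0)%R])%E = (fun n =>
  'N[P]_p[EFin \o Y n])%E.
  apply/funext => n; congr Lnorm; apply/funext => w /=.
  by rewrite subr0.
apply/fine_cvgP; split.
  near=> n; rewrite ge0_fin_numE ?Lnorm_ge0//.
  apply: (@le_lt_trans _ _ (1 + v n)%:E); last exact: ltry.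
  apply: N_le; first by rewrite ltr_wpDr.
  by rewrite -subr_ge0 (_ : _ - _ = 1 + v n + v n ^+ 2) ?addr_ge0 ?sqr_ge0//;
    ring.
apply/cvgrPdist_le => e e0; near=> n.
rewrite sub0r normrN /= ger0_norm; last by rewrite fine_ge0// Lnorm_ge0.
have h : ('N[P]_p[EFin \o Y n] <= e%:E)%E.
  apply: N_le => //; near: n.
  have e20 : 0 < e ^+ 2 by rewrite exprn_gt0.
  exact: (cvgr_le _ v0).
rewrite -lee_fin fineK// ge0_fin_numE ?Lnorm_ge0//.
by apply: le_lt_trans h _; rewrite ltry.
Unshelve. all: by end_near. Qed.

(** The first Borel-Cantelli lemma, for a summable real bound on the
    probabilities. *)
Lemma borel_cantelli (F : nat -> set Omega) (v : nat -> R) (c : R) :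
  (forall n, measurable (F n)) -> (forall n, (P (F n) <= (v n)%:E)%E) ->
  (forall n, \sum_(k < n) v k <= c) ->
  {ae P, forall w, exists N, forall n, (N <= n)%N -> ~ F n w}.
Proof.
move=> mF Fv vc; exists (lim_sup_set F); split.
- by apply: bigcapT_measurable => n; exact: bigcup_measurable.
- apply: lim_sup_set_cvg0 => //; apply: (@le_lt_trans _ _ c%:E);
  last exact: ltry.
  apply: lime_le; first exact: is_cvg_nneseries.
  apply: nearW => n; rewrite big_mkord.
  apply: (@le_trans _ _ (\sum_(k < n) (v k)%:E)%E);
    first by apply: lee_sum => k _; exact: Fv.
  by rewrite sumEFin lee_fin.
- move=> w /= h N _; apply: contrapT => hN; apply: h; exists N => n Nn Fn.
  by apply: hN; exists n.
Qed.

End SecondMoment.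

(** A strong law for variables [T n] whose variances grow at most linearly and
    whose increments [T (k + m) - T k] are dominated by [S k m], with a mean of
    order [m] and a second moment of order [m ^ 2]. Chebyshev's inequality and
    the Borel-Cantelli lemma give the convergence along the squares
    [n = k ^ 2], and [S (k ^ 2) (2 * k)] controls the gap up to the next
    square. *)
Section StrongLaw.
Context (disp : measure_display) (Omega : measurableType disp) (R : realType).
Variable P : probability Omega R.
Variables (T : nat -> Omega -> R) (S : nat -> nat -> Omega -> R) (a b C : R).
Hypothesis mT : forall n, measurable_fun [set: Omega] (T n).
Hypothesis mS : forall k m, measurable_fun [set: Omega] (S k m).
Hypothesis S_ge0 : forall k m w, 0 <= S k m w.
Hypothesis S_mono : forall k m m' w, (m <= m')%N -> S k m w <= S k m' w.
Hypothesis TS : forall k m w, `|T (k + m) w - T k w| <= S k m w.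
Hypothesis T2 : forall n, (\int[P]_w (T n w ^+ 2)%:E < +oo)%E.
Hypothesis ES : forall k m, (\int[P]_w (S k m w)%:E <= (a * m%:R)%:E)%E.
Hypothesis ES2 : forall k m, (\int[P]_w (S k m w ^+ 2)%:E <= (b * m%:R ^+
  2)%:E)%E.
Hypothesis VT : forall n, (0 < n)%N ->
  \int[P]_w (T n w ^+ 2) - (\int[P]_w T n w) ^+ 2 <= C * n%:R.

Let mu n := \int[P]_w T n w.

Let a0 : 0 <= a.
Proof.
have := ES 0 1; rewrite mulr1 -lee_fin; apply: le_trans.
by apply: integral_ge0 => w _; rewrite lee_fin.
Qed.

Let b0 : 0 <= b.
Proof.
have := ES2 0 1; rewrite expr1n mulr1 -lee_fin; apply: le_trans.
by apply: integral_ge0 => w _; rewrite lee_fin sqr_ge0.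
Qed.

Let iT n : P.-integrable [set: Omega] (EFin \o T n).
Proof. exact: sqr_integrable_integrable. Qed.

Let mu_dist k m : `|mu (k + m) - mu k| <= a * m%:R.
Proof.
rewrite /mu -RintegralB//.
have iB : P.-integrable [set: Omega] (EFin \o (fun w => T (k + m) w - T k w)).
  exact: (integrableB measurableT (iT (k + m)) (iT k)).
apply: (le_trans (le_normr_Rintegral measurableT iB)).
rewrite -lee_fin /Rintegral fineK; last first.
  have /integrableP[_] := iB; rewrite ge0_fin_numE//.
  by apply: integral_ge0 => w _; rewrite lee_fin.
apply: le_trans (ES k m); apply: ge0_le_integral => //.
- by apply/measurable_EFinP; apply: measurableT_comp => //;
  exact: measurable_funB.
- exact/measurable_EFinP.
- by move=> w _; rewrite lee_fin.
Qed.

(* The deviations of [T], and of its increments, at the scale [e * k ^ 2]. *)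
Let bad (e : R) (k : nat) : set Omega :=
  [set w | e * (k ^ 2)%:R <= `|T (k ^ 2) w - mu (k ^ 2)|] `|`
  [set w | e * (k ^ 2)%:R <= `|S (k ^ 2) (2 * k) w|].

Let measurable_ge_norm (Y : Omega -> R) (e : R) : measurable_fun [set: Omega] Y
  ->
  measurable [set w | e <= `|Y w|].
Proof. by move=> mY; apply: measurable_ge_cst; exact: measurableT_comp. Qed.

Let mTmu n : measurable_fun [set: Omega] (fun w => T n w - mu n).
Proof. by apply: measurable_funB => //; exact: measurable_cst. Qed.

Let measurable_bad e k : measurable (bad e k).
Proof. by apply: measurableU; exact: measurable_ge_norm. Qed.

Let bad_probability e k : 0 < e ->
  (P (bad e k.+1) <= ((C + 4 * b) / e ^+ 2 * k.+1%:R ^- 2)%:E)%E.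
Proof.
move=> e0; have k0 : 0 < (k.+1)%:R :> R by rewrite ltr0n.
have ek : 0 < e * (k.+1 ^ 2)%:R by rewrite mulr_gt0// ltr0n expn_gt0.
apply: (le_trans (measureU2 P (measurable_ge_norm _ (mTmu _))
  (measurable_ge_norm _ (mS _ _)))).
apply: (le_trans (leeD (markov_sqr P (mTmu _) ek) (markov_sqr P (mS _ _) ek))).
rewrite centered_second_moment// -ge0_muleDr; last 2 first.
- rewrite -centered_second_moment//; apply: integral_ge0 => w _.
  by rewrite lee_fin sqr_ge0.
- by apply: integral_ge0 => w _; rewrite lee_fin sqr_ge0.
apply: (@le_trans _ _ (((e * (k.+1 ^ 2)%:R) ^- 2)%:E * ((C * (k.+1 ^ 2)%:R)%:E
  + (b * (2 * k.+1)%:R ^+ 2)%:E))%E).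
  rewrite lee_wpmul2l ?lee_fin ?invr_ge0 ?sqr_ge0// leeD//.
  by rewrite lee_fin VT// expn_gt0.
rewrite -EFinD -EFinM lee_fin le_eqVlt; apply/orP; left; apply/eqP.
rewrite natrX natrM; field.
by rewrite !lt0r_neq0.
Qed.

Lemma strong_law : {ae P, forall w, (T n w - mu n) / n%:R @[n --> \oo] --> (0 :
  R)}.
Proof.
have h j : {ae P, forall w, exists N, forall k, (N <= k)%N -> ~ bad j.+1%:R^-1
  k.+1 w}.
  have e0 : 0 < j.+1%:R^-1 :> R by rewrite invr_gt0 ltr0n.
  have C0 : 0 <= C.
    have := VT (ltn0Sn 0); rewrite mulr1; apply: le_trans.
    rewrite -lee_fin -centered_second_moment//; apply: integral_ge0 => w _.
    by rewrite lee_fin sqr_ge0.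
  apply: (borel_cantelli (c := (C + 4 * b) / j.+1%:R^-1 ^+ 2 * 2)).
  - by move=> k; exact: measurable_bad.
  - by move=> k; exact: bad_probability.
  - move=> n; rewrite -mulr_sumr ler_wpM2l ?sum_inverse_squares//.
    by rewrite divr_ge0 ?sqr_ge0// addr_ge0// mulr_ge0.
have {}h : {ae P, forall w, forall j, exists N, forall k, (N <= k)%N -> ~ bad
  j.+1%:R^-1 k.+1 w}.
  exact: ae_foralln.
apply: filterS h => w hw; apply/cvgrPdist_le => e e0.
have [j je] : exists j, j.+1%:R^-1 <= e / 3.
  have e3 : 0 < e / 3 by rewrite divr_gt0.
  have [j _ hj] := near_infty_natSinv_lt (PosNum e3).
  by exists j; apply/ltW/hj => /=.
have [N hN] := hw j.
set de : R := j.+1%:R^-1 in hN je.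
have de0 : 0 < de by rewrite invr_gt0 ltr0n.
(* Beyond [M], the means vary by at most [de * k ^ 2] between two squares. *)
have [M hM] : exists M : nat, 3 * a / de <= M%:R.
  exists (Num.Def.archi_bound (3 * a / de)); apply/ltW/archi_boundP.
  by rewrite divr_ge0 ?mulr_ge0// ltW.
exists ((maxn N M).+2 ^ 2)%N => // n /= hn.
have [k /andP[kn nk]] := sqrt_bounds n.
have kNM : (maxn N M < k)%N.
  by have := leq_ltn_trans hn nk; rewrite ltn_exp2r// ltnS => /ltnW.
case: k kn nk kNM => [//|k] kn nk; rewrite ltnS => kNM.
have Nk : (N <= k)%N := leq_trans (leq_maxl _ _) kNM.
have Mk : (M <= k.+1)%N by rewrite (leq_trans (leq_maxr N M))// (leq_trans kNM).
have := hN k Nk; rewrite /bad => /not_orP[/negP + /negP].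
rewrite -!ltNge => h1; rewrite ger0_norm// => h2.
pose m := (n - k.+1 ^ 2)%N; have nE : n = (k.+1 ^ 2 + m)%N by rewrite subnKC.
have m2k : (m <= 2 * k.+1)%N.
  by move: nk; rewrite /m leq_subLR -ltnS -!mulnn; lia.
have n0 : 0 < n%:R :> R by rewrite ltr0n (leq_trans _ kn)// expn_gt0.
have kn' : (k.+1 ^ 2)%:R <= n%:R :> R by rewrite ler_nat.
rewrite sub0r normrN normrM [X in _ * X]ger0_norm ?invr_ge0// ler_pdivrMr//.
have t1 : `|T n w - T (k.+1 ^ 2) w| <= de * (k.+1 ^ 2)%:R.
  by rewrite nE; apply: (le_trans (TS _ _ _)); apply: le_trans (ltW h2);
    exact: S_mono.
have t2 : `|mu n - mu (k.+1 ^ 2)| <= de * (k.+1 ^ 2)%:R.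
  rewrite nE; apply: (le_trans (mu_dist _ _)).
  apply: (@le_trans _ _ (a * (2 * k.+1)%:R));
    first by rewrite ler_wpM2l// ler_nat.
  have : 3 * a <= de * k.+1%:R.
    rewrite -ler_pdivrMl// mulrC; apply: (le_trans hM); by rewrite ler_nat.
  move=> h3; have k1 : 0 <= k.+1%:R :> R by [].
  have := ler_wpM2r k1 h3; have := mulr_ge0 a0 k1; rewrite natrX natrM.
  by move: (k.+1%:R : R) => x; lra.
have := ler_normD (T n w - T (k.+1 ^ 2) w) (T (k.+1 ^ 2) w - mu (k.+1 ^ 2)).
have := ler_normD (T n w - mu (k.+1 ^ 2)) (mu (k.+1 ^ 2) - mu n).
rewrite (distrC (mu (k.+1 ^ 2)) (mu n)) !subrKA => u1 u2.
have : de * (k.+1 ^ 2)%:R <= e / 3 * n%:R.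
  by apply: ler_pM => //; exact: ltW.
lra.
Unshelve. all: by end_near. Qed.

End StrongLaw.

Lemma limn_einf_ge (R : realType) (u : nat -> R) (l : R) (N : nat) :
  (forall n, (N <= n)%N -> l <= u n) -> (l%:E <= limn_einf (fun n => (u
    n)%:E))%E.
Proof.
move=> h; rewrite limn_einf_lim; apply: lime_ge; first exact: is_cvg_einfs.
exists N => // n /= Nn; apply: le_ereal_inf_tmp => _ [k /= nk <-].
by rewrite lee_fin h// (leq_trans Nn).
Qed.

Lemma limn_esup_le (R : realType) (u : nat -> R) (l : R) (N : nat) :
  (forall n, (N <= n)%N -> u n <= l) -> (limn_esup (fun n => (u n)%:E) <=
    l%:E)%E.
Proof.
move=> h; rewrite limn_esup_lim; apply: lime_le; first exact: is_cvg_esups.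
exists N => // n /= Nn; apply: ge_ereal_sup => _ [k /= nk <-].
by rewrite lee_fin h// (leq_trans Nn).
Qed.

(** * First passage percolation with independent weights *)

(** The infimum over the countably many paths is the real part of an infimum of
    extended reals: both are 0 when the passage times are not bounded below. *)
Lemma measurable_first_passage_time (disp : measure_display)
    (Omega : measurableType disp) (R : realType) (d : nat) (d0 : (0 < d)%N)
    (t : {fset 'rV[int]_d} -> Omega -> R) (n : nat) :
  (forall e, measurable_fun [set: Omega] (t e)) ->
  measurable_fun [set: Omega] (fun w => first_passage_time (t ^~ w) n).
Proof.
move=> mt.
pose h (k : nat) (w : Omega) : \bar R :=
  if choice.unpickle k is Some p then
    if self_avoiding_path 0 (axis_point d n) p
    then (passage_time (t ^~ w) 0 p)%:E else +oo%E
  else +oo%E.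
have mh k : measurable_fun [set: Omega] (h k).
  rewrite /h; case: (choice.unpickle k) => [p|]; last exact: measurable_cst.
  case: (self_avoiding_path _ _ p); last exact: measurable_cst.
  apply/measurable_EFinP; rewrite /passage_time.
  elim: (path_edges 0 p) => [|e s IH].
    by under eq_fun do rewrite big_nil; exact: measurable_cst.
  by under eq_fun do rewrite big_cons; exact: measurable_funD.
have -> : (fun w => first_passage_time (t ^~ w) n) = (fun w => fine (einfs (h
  ^~ w) 0)).
  apply/funext => w; rewrite /first_passage_time.
  set E := [set _ | _ in _].
  have E0 : E (passage_time (t ^~ w) 0 (axis_path d n)).
    by exists (axis_path d n) => //; exact: self_avoiding_axis_path.
  have -> : einfs (h ^~ w) 0 = ereal_inf [set x%:E | x in E].
    apply/eqP; rewrite eq_le; apply/andP; split.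
      apply: le_ereal_inf_tmp => _ [_ [p /= sp <-] <-].
      apply: ereal_inf_lbound; exists (choice.pickle p) => //.
      by rewrite /h choice.pickleK sp.
    apply: le_ereal_inf_tmp => _ [k _ <-]; rewrite /h.
    case: (choice.unpickle k) => [p|]; last exact: leey.
    have [sp|_] := boolP (self_avoiding_path _ _ p); last exact: leey.
    by apply: ereal_inf_lbound; exists (passage_time (t ^~ w) 0 p) => //;
      exists p.
  have [lE|nlE] := pselect (has_lbound E).
    by rewrite ereal_inf_EFin//; exists (passage_time (t ^~ w) 0 (axis_path d
      n)).
  rewrite inf_out; last by case.
  have : lbound [set x%:E | x in E] (ereal_inf [set x%:E | x in E]).
    by move=> x; exact: ereal_inf_lbound.
  case: (ereal_inf _) => [r| |]// hr.
  exfalso; apply: nlE; exists r => x Ex.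
  by have := hr _ (imageP _ Ex); rewrite lee_fin.
apply: measurableT_comp; last exact: measurable_fun_einfs.
exact: fine_measurable.
Qed.

Section Moments.
Context (R : realType) (disp : measure_display)
  (Omega : measurableType disp) (P : probability Omega R).
Variable X : nat -> Omega -> R.
Hypothesis mX : forall i, measurable_fun [set: Omega] (X i).
Hypothesis h0 : vanishing_near_zero P X.

Lemma small_values (c : R) : 0 < c ->
  exists2 eps, 0 < eps & forall i, (P [set w | (X i w < eps)%R] <= c%:E)%E.
Proof.
move=> c0; have /fine_cvgP[h1 h3] := h0.
have h4 : \forall e \near 0^'+, fine (ereal_sup (range (fun i => P [set w | (X
  i w < e)%R]))) <= c.
  exact: (cvgr_le _ h3).
have h5 : \forall e \near 0^'+, 0 < (e : R) by exact: nbhs_right_gt.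
have [e [[he1 he2] he3]] := filter_ex (filterI (filterI h1 h4) h5).
exists e => // i; rewrite /= in he1 he2.
apply: (@le_trans _ _ (ereal_sup (range (fun i => P [set w | (X i w < e)%R])))).
  by apply: ereal_sup_ubound; exists i.
by rewrite -(fineK he1) lee_fin.
Qed.

Lemma negative_null i : P [set w | X i w < 0] = 0%E.
Proof.
apply/eqP; rewrite eq_le measure_ge0 andbT; apply/lee_addgt0Pr => c c0;
  rewrite add0e.
have [e e0 he] := small_values c0; apply: le_trans (he i).
apply: le_measure; rewrite ?inE; try exact: measurable_lt_cst.
by move=> w /= /lt_trans; exact.
Qed.

Lemma ae_nonnegative : {ae P, forall w, forall i, 0 <= X i w}.
Proof.
apply: ae_foralln => i; exists [set w | X i w < 0]; split.
- exact: measurable_lt_cst.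
- exact: negative_null.
- by move=> w /= /negP; rewrite -ltNge.
Qed.

(* A bound [c + Y i] on the squares need only hold where the weights are
   nonnegative. *)
Let bounded_second_moments_of (Y : nat -> Omega -> R) (c s : R) : 0 <= c ->
  (forall i, measurable_fun [set: Omega] (Y i)) ->
  (forall i w, 0 <= Y i w) ->
  (forall i w, 0 <= X i w -> X i w ^+ 2 <= c + Y i w) ->
  (forall i, (\int[P]_w (Y i w)%:E <= s%:E)%E) -> bounded_second_moments P X.
Proof.
move=> c0 mY Y0 XY Ys.
apply: (@le_lt_trans _ _ (c + s)%:E); last exact: ltry.
apply: ge_ereal_sup => _ [i _ <-]; rewrite unlock.
apply: (@le_trans _ _ (\int[P]_w (c%:E + (Y i w)%:E)%E)%E).
  apply: ae_ge0_le_integral => //.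
  - by move=> w _; rewrite lee_fin sqr_ge0.
  - by apply/measurable_EFinP; exact: measurable_funX.
  - by move=> w _; rewrite -EFinD lee_fin addr_ge0.
  - by apply: emeasurable_funD; [exact: measurable_cst|exact/measurable_EFinP].
  - by apply: filterS ae_nonnegative => w hw _; rewrite -EFinD lee_fin XY.
rewrite ge0_integralD//; last 2 first.
- by move=> w _; rewrite lee_fin.
- exact/measurable_EFinP.
by rewrite integral_cst//= probability_setT mule1 EFinD leeD2l.
Qed.

Lemma bounded_second_moments_of_tails :
  vanishing_second_moment_tails P X -> bounded_second_moments P X.
Proof.
move=> /fine_cvgP; set g := (fun M : R => ereal_sup _) => -[h1 h3].
have h4 : \forall M \near +oo, fine (g M) <= 1 by exact: (cvgr_le _ h3).
have h5 : \forall M \near +oo, 0 <= (M : R) by exact: nbhs_pinfty_ge.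
have [M [[/= hM1 hM2] hM3]] := filter_ex (filterI (filterI h1 h4) h5).
have mI i : measurable [set u | M <= X i u] by exact: measurable_ge_cst.
apply: (@bounded_second_moments_of (fun i w => X i w ^+ 2 * \1_[set u | M <= X
  i u] w) (M ^+ 2) 1).
- exact: sqr_ge0.
- by move=> i; apply: measurable_funM;
  [exact: measurable_funX|exact: measurable_indic].
- by move=> i w; rewrite mulr_ge0 ?sqr_ge0.
- move=> i w Xw; rewrite indicE; have [MX|XM] := lerP M (X i w).
    by rewrite mem_set// mulr1 lerDr sqr_ge0.
  rewrite memNset/= ?mulr0 ?addr0; last by rewrite leNgt XM.
  by rewrite lerXn2r// ltW.
- move=> i; apply: (@le_trans _ _ (fine (g M))%:E); last by rewrite lee_fin.
  rewrite fineK//; apply: ereal_sup_ubound; exists i => //.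
  by rewrite unlock.
Qed.

Lemma bounded_second_moments_of_higher :
  bounded_higher_moments P X -> bounded_second_moments P X.
Proof.
move=> [p [p2]]; set s := ereal_sup _ => s_lty.
have hs i : (\int[P]_w (X i w `^ p)%:E <= s)%E.
  by apply: ereal_sup_ubound; exists i => //; rewrite unlock.
apply: (@bounded_second_moments_of (fun i w => X i w `^ p) 1 (fine s)) => //.
- by move=> i; apply: (measurableT_comp (measurable_powR _)).
- by move=> i w; exact: powR_ge0.
- move=> i w Xw; have [X1|X1] := lerP (X i w) 1.
    by apply: (@le_trans _ _ 1); rewrite ?lerDl ?powR_ge0// exprn_ile1.
  rewrite -powR_mulrn//; apply: (@le_trans _ _ (X i w `^ p));
    last by rewrite lerDr.
  by rewrite ler_powR// ltW.
- move=> i; rewrite fineK// ge0_fin_numE//.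
  apply: le_trans (hs 0%N); apply: integral_ge0 => w _.
  by rewrite lee_fin powR_ge0.
Qed.

End Moments.

Section Main.
Context (d : nat) (R : realType) (disp : measure_display)
  (Omega : measurableType disp) (P : probability Omega R).
Variables (q : nat -> {fset 'rV[int]_d}) (t : {fset 'rV[int]_d} -> {RV P >->
  R}).
Hypothesis d0 : (0 < d)%N.
Hypothesis hq : set_bij [set: nat] (@lattice_edges d) q.
Let X : nat -> Omega -> R := fun i => t (q i).
Hypothesis hind : mutually_independent P X.
Hypothesis h0 : vanishing_near_zero P X.
Hypothesis h2 : bounded_second_moments P X.

Let T : nat -> Omega -> R := fun n w => first_passage_time (t ^~ w) n.
Let Z : nat -> Omega -> R := fun n w => centered P (T n) w / n%:R.

Let mX i : measurable_fun [set: Omega] (X i).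
Proof. exact: measurable_funPT. Qed.

(* The number of an edge in the enumeration [q], which is 0 off the lattice. *)
Let idx (e : {fset 'rV[int]_d}) : nat := xget 0%N [set i | q i = e].

Let q_idx e : lattice_edges e -> q (idx e) = e.
Proof.
move=> le; have [_ _ qs] := hq; have [i _ qi] := qs e le.
by apply: (@xgetPex _ 0%N [set i | q i = e]); exists i.
Qed.

Let idx_inj (e e' : {fset 'rV[int]_d}) :
  lattice_edges e -> lattice_edges e' -> idx e = idx e' -> e = e'.
Proof. by move=> /q_idx {2}<- /q_idx {2}<- ->. Qed.

Let second_moment : exists M2 : R, forall i, (\int[P]_w (X i w ^+ 2)%:E <=
  M2%:E)%E.
Proof.
move: h2; rewrite /bounded_second_moments; set s := ereal_sup _ => s_lty.
have hs i : (\int[P]_w (X i w ^+ 2)%:E <= s)%E.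
  by apply: ereal_sup_ubound; exists i => //; rewrite unlock.
exists (fine s) => i; rewrite fineK// ge0_fin_numE//.
apply: le_trans (hs 0%N); apply: integral_ge0 => w _.
by rewrite lee_fin sqr_ge0.
Qed.

(* The first passage time for the positive parts of the weights, with which it
   agrees almost surely. *)
Let Tc (n : nat) (w : Omega) : R := first_passage_time (edge_weights idx (X ^~
  w)) n.

Let T_ae : {ae P, forall w, forall n, T n w = Tc n w}.
Proof.
apply: filterS (ae_nonnegative mX h0) => w hw n;
  apply: eq_first_passage_time => e le.
by rewrite /edge_weights max_r// /X q_idx.
Qed.

Let mT n : measurable_fun [set: Omega] (T n).
Proof. by apply: measurable_first_passage_time => // e;
  exact: measurable_funPT. Qed.

(** Vanishing mass near 0 and bounded second moments suffice for all the
    conclusions, in [L^1] and in [L^2] alike. *)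
Lemma first_passage_law :
  [/\ cvg_almost_surely P Z (cst 0),
      forall p : \bar R, p = 1%E \/ p = 2%:E -> cvg_Lp P p Z (cst 0),
      exists C : R, 0 < C /\ forall n : nat, (1 <= n)%N ->
        ('V_P[centered P (T n)] <= (C * n%:R)%:E)%E &
      linear_growth P T].
Proof.
have d8 : 0 < (8 * d)%:R ^- 2 :> R by rewrite invr_gt0 exprn_gt0// ltr0n
  muln_gt0 d0.
have [eps eps0 few_small] := small_values h0 d8.
have [M2 hM2] := second_moment.
have M20 := second_moment_ge0 hM2.
have beta0 : 0 < eps / 2 by rewrite divr_gt0.
(* The last summand makes [C] positive. *)
pose C := M2 * ((eps / 2)^-1 * (1 + M2) + 2) + 1.
have C0 : 0 < C.
  by rewrite ltr_wpDl// mulr_ge0// addr_ge0// mulr_ge0 ?invr_ge0 ?addr_ge0//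
    ltW.
have mTc n : measurable_fun [set: Omega] (Tc n).
  exact: (measurable_first_passage_weights mX).
have Tc2 n : (\int[P]_w (Tc n w ^+ 2)%:E < +oo)%E.
  by apply: (le_lt_trans (integral_sqr_first_passage mX idx d0 hM2 n));
    rewrite ltry.
have VT n : (0 < n)%N ->
    \int[P]_w (Tc n w ^+ 2) - (\int[P]_w Tc n w) ^+ 2 <= C * n%:R.
  move=> n0; have n1 : 1 <= n%:R :> R by rewrite ler1n.
  apply: (le_trans (first_passage_variance mX hind d0 idx_inj eps0 few_small
    hM2 n)).
  rewrite /C; have := mulr_ge0 M20 (ler0n R 2);
    set A := (eps / 2)^-1 * (1 + M2).
  have -> : (eps / 2)^-1 * ((1 + M2) * n%:R) = A * n%:R by rewrite mulrA.
  move=> h; have : M2 * 2 * 1 <= M2 * 2 * n%:R by rewrite ler_wpM2l.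
  rewrite mulr1; nra.
pose mu n := \int[P]_w Tc n w.
have as_cvg : {ae P, forall w, (Tc n w - mu n) / n%:R @[n --> \oo] --> (0 : R)}.
  apply: (@strong_law _ _ _ P Tc (segment_time X idx) (1 + M2) M2 C) => //.
  - by move=> k m; exact: measurable_segment_time.
  - by move=> k m w; exact: segment_time_ge0.
  - move=> k m m' w /subnKC <-; rewrite /segment_time big_split_ord/=.
    by rewrite lerDl; apply: sumr_ge0 => i _; exact: edge_weights_ge0.
  - by move=> k m w; apply: first_passage_time_dist => // e;
    exact: edge_weights_ge0.
  - by move=> k m; exact: integral_segment_time.
  - by move=> k m; exact: integral_sqr_segment_time.
have ET n : 'E_P[T n]%E = (mu n)%:E.
  rewrite unlock /mu /Rintegral fineK; last first.
    by apply: (integrable_fin_num measurableT);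
      exact: sqr_integrable_integrable.
  apply: ae_eq_integral => //; [exact/measurable_EFinP|exact/measurable_EFinP|].
  by apply: filterS T_ae => w hw _; rewrite hw.
have cE n w : centered P (T n) w = T n w - mu n by rewrite /centered ET.
have mcT n : measurable_fun [set: Omega] (fun w => T n w - mu n).
  by apply: measurable_funB => //; exact: measurable_cst.
have cT2 n : (\int[P]_w ((T n w - mu n) ^+ 2)%:E)%E =
    (\int[P]_w (Tc n w ^+ 2) - mu n ^+ 2)%:E.
  rewrite -centered_second_moment//.
  apply: ae_eq_integral => //.
  - by apply/measurable_EFinP; exact: measurable_funX.
  - by apply/measurable_EFinP; apply: measurable_funX;
    apply: measurable_funB => //; exact: measurable_cst.
  - by apply: filterS T_ae => w hw _; rewrite hw.
have Z_ae : {ae P, forall w, Z n w @[n --> \oo] --> (0 : R)}.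
  apply: filterS2 T_ae as_cvg => w hw.
  have -> // : (fun n => Z n w) = (fun n => (Tc n w - mu n) / n%:R).
  by apply/funext => n; rewrite /Z cE hw.
split.
- exact: Z_ae.
- move=> p hp; apply: (cvg_Lp_second_moment (v := fun n => C / n%:R)) => //.
  + move=> n; rewrite /Z; under eq_fun do rewrite cE.
    by apply: measurable_funM => //; exact: measurable_cst.
  + move=> n; have [->|n0] := posnP n.
      rewrite mulr0n invr0 mulr0; under eq_integral do rewrite /Z mulr0n invr0
        mulr0 expr0n/=.
      by rewrite integral0.
    have nR : 0 < n%:R :> R by rewrite ltr0n.
    have -> : (\int[P]_w (Z n w ^+ 2)%:E)%E =
        ((n%:R ^- 2)%:E * \int[P]_w ((T n w - mu n) ^+ 2)%:E)%E.
      rewrite -ge0_integralZl//; last 2 first.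
      * by apply/measurable_EFinP; exact: measurable_funX.
      * by move=> w _; rewrite lee_fin sqr_ge0.
      apply: eq_integral => w _; rewrite /Z cE -EFinM; congr EFin.
      by rewrite exprMn exprVn mulrC.
    rewrite cT2 -EFinM lee_fin; apply: (@le_trans _ _ (n%:R ^- 2 * (C * n%:R))).
      by rewrite ler_wpM2l ?invr_ge0 ?sqr_ge0// VT.
    rewrite le_eqVlt; apply/orP; left; apply/eqP; field.
    exact: lt0r_neq0.
  + apply/cvgrPdist_le => e e0; near=> n.
    have n0 : 0 < n%:R :> R by rewrite ltr0n; near: n; exact: nbhs_infty_gt.
    rewrite sub0r normrN ger0_norm; last by rewrite divr_ge0// ltW.
    rewrite ler_pdivrMr// -ler_pdivrMl//; near: n.
    exact: nbhs_infty_ger.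
- exists C; split => // n n0.
  have -> : 'V_P[centered P (T n)] = (\int[P]_w ((T n w - mu n) ^+ 2)%:E)%E.
    have cE0 : 'E_P[centered P (T n)]%E = 0%E.
      rewrite unlock; under eq_integral do rewrite cE.
      transitivity (\int[P]_w (Tc n w - mu n)%:E)%E.
        apply: ae_eq_integral => //; [exact/measurable_EFinP| |].
          by apply/measurable_EFinP; apply: measurable_funB => //;
            exact: measurable_cst.
        by apply: filterS T_ae => w hw _; rewrite hw.
      have i1 := sqr_integrable_integrable (mTc n) (Tc2 n).
      have i2 : P.-integrable [set: Omega] (EFin \o cst (mu n)).
        exact: finite_measure_integrable_cst.
      rewrite integralB_EFin// integral_cst//= probability_setT mule1.
      rewrite -[X in (X - _)%E]fineK ?subee//.
      exact: (integrable_fin_num measurableT i1).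
    rewrite /variance unlock cE0 unlock; apply: eq_integral => w _.
    by rewrite /= !fctE/= subr0 cE expr2.
  by rewrite cT2 lee_fin VT.
- exists (eps / 2), (2 + M2); split => //; first by rewrite ltr_wpDr.
  (* Almost surely, long paths from the origin take time [eps / 2] per edge. *)
  have slow : {ae P, forall w, exists N, forall r, (N <= r)%N -> ~ fast_path X
    idx eps r w}.
    apply: (borel_cantelli (v := fun r => 2 ^- r) (c := 2)).
    + by move=> r; exact: measurable_fast_path.
    + by move=> r; exact: fast_path_probability.
    + move=> n.
      suff -> : \sum_(k < n) 2 ^- k = 2 - 2 * 2 ^- n :> R.
        by rewrite gerBl mulr_ge0 ?invr_ge0 ?exprn_ge0.
      elim: n => [|n IH]; first by rewrite big_ord0 expr0 invr1 mulr1 subrr.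
      by rewrite big_ord_recr/= IH exprS; field; rewrite expf_neq0.
  apply: filterS3 T_ae slow Z_ae => w hT [N hN] hZ; split.
  + apply: (@limn_einf_ge _ _ _ N.+1) => n Nn.
    have n0 : 0 < n%:R :> R by rewrite ltr0n (leq_trans _ Nn).
    rewrite ler_pdivlMr// hT; apply: (first_passage_time_ge d0) => p sp.
    have np := size_self_avoiding d0 sp.
    case/and3P: sp => pp _ up.
    have := hN _ (leq_trans (ltnW Nn) np); move/forallNP => /(_ p) hp.
    have : eps / 2 * (size p)%:R <= passage_time (edge_weights idx (X ^~ w)) 0
      p.
      by rewrite leNgt; apply/negP => hlt; exact: hp.
    by apply: le_trans; rewrite ler_wpM2l ?ler_nat// ltW.
  + exact: limn_einf_sup.
  + have [M _ hM] := cvgr_le _ hZ _ (@ltr01 R).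
    apply: (@limn_esup_le _ _ _ (maxn 1 M)) => n;
      rewrite geq_max => /andP[n1 Mn].
    have n0 : 0 < n%:R :> R by rewrite ltr0n.
    have := hM n Mn; rewrite /= /Z cE !ler_pdivrMr// mul1r => h.
    have : mu n <= (1 + M2) * n%:R.
      rewrite -lee_fin /mu /Rintegral fineK;
        first exact: integral_first_passage.
      by apply: (integrable_fin_num measurableT);
        exact: sqr_integrable_integrable.
    by move=> h'; rewrite -lerBrDr in h; lra.
Unshelve. all: by end_near. Qed.

End Main.

Theorem theorem1 (d : nat) (hd : (2 <= d)%N)
    (R : realType) (disp : measure_display) (Omega : measurableType disp)
    (P : probability Omega R)
    (q : nat -> {fset 'rV[int]_d})
    (hq : set_bij [set: nat] (@lattice_edges d) q)
    (t : {fset 'rV[int]_d} -> {RV P >-> R})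
    (hind : mutually_independent P (fun i => t (q i))) :
  let X : nat -> Omega -> R := fun i => t (q i) in
  let T : nat -> Omega -> R := fun n w => first_passage_time (t ^~ w) n in
  let Z : nat -> Omega -> R := fun n w => centered P (T n) w / n%:R in
  [/\ vanishing_near_zero P X -> bounded_second_moments P X ->
        [/\ cvg_almost_surely P Z (cst 0),
            cvg_Lp P 1%E Z (cst 0) &
            linear_growth P T],
      vanishing_near_zero P X -> vanishing_second_moment_tails P X ->
        [/\ cvg_almost_surely P Z (cst 0),
            cvg_Lp P 2%:E Z (cst 0) &
            linear_growth P T] &
      vanishing_near_zero P X -> bounded_higher_moments P X ->
        [/\ cvg_almost_surely P Z (cst 0),
            cvg_Lp P 2%:E Z (cst 0),
            (exists C : R, 0 < C /\
              forall n : nat, (1 <= n)%N ->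
                ('V_P[centered P (T n)] <= (C * n%:R)%:E)%E) &
            linear_growth P T]].
Proof.
move=> X T Z.
have d0 : (0 < d)%N by exact: leq_trans hd.
have mX i : measurable_fun [set: Omega] (X i) by exact: measurable_funPT.
split=> h0 h1.
- have [as_cvg Lp_cvg _ growth] := first_passage_law d0 hq hind h0 h1.
  by split => //; apply: Lp_cvg; left.
- have h2 := bounded_second_moments_of_tails mX h0 h1.
  have [as_cvg Lp_cvg _ growth] := first_passage_law d0 hq hind h0 h2.
  by split => //; apply: Lp_cvg; right.
- have h2 := bounded_second_moments_of_higher mX h0 h1.
  have [as_cvg Lp_cvg var_le growth] := first_passage_law d0 hq hind h0 h2.
  by split => //; apply: Lp_cvg; right.
Qed.
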